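(* Let $K\subseteq\mathbb{R}^n$ be a convex body containing the origin and let $h:K\to[0,\infty)$ be a concave function. Then, for any $0<p\leq q$, $$ \left(\frac{\binom{n+q}{n}}{G_n(K)}\int_K h^q(x)\,dG_n(x)\right)^{1/q}\leq\left(\frac{\binom{n+p}{n}}{G_n(K)}\int_{K+C_n}(h\star\chi_{C_n})^p(x)\,dG_n(x)\right)^{1/p}. $$
   Context: A convex body is a compact convex set with non-empty interior. $G_n$ is the lattice point enumerator measure, $G_n(A)=\#(A\cap\mathbb{Z}^n)$. $C_n=(-1,1)^n$. The function $h\star\chi_{C_n}:K+C_n\to[0,\infty)$ is $(h\star\chi_{C_n})(x)=\sup\{h(x-u): u\in C_n,\ x-u\in K\}$. For real $p>0$, $\binom{n+p}{n}=\frac{\Gamma(n+p+1)}{\Gamma(n+1)\Gamma(p+1)}$. *)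

(* Defs.v *)
From HB Require Import structures.
From mathcomp Require Import all_boot all_order all_algebra.
From mathcomp Require Import all_classical all_reals all_analysis.

Set Implicit Arguments.
Unset Strict Implicit.
Unset Printing Implicit Defensive.

Import Order.TTheory GRing.Theory Num.Theory.
Import numFieldNormedType.Exports.

Local Open Scope classical_set_scope.
Local Open Scope ring_scope.
Local Open Scope convex_scope.

Definition convex_body (R : realType) (n : nat) (K : set 'rV[R]_n) : Prop :=
  [/\ convex_set K, compact K & K° !=set0].

Definition concave_function (R : realType) (n : nat) (K : set 'rV[R]_n)
    (h : 'rV[R]_n -> R) : Prop :=
  forall t : {i01 R}, {in K &, forall x y : convex_lmodType 'rV[R]_n,
    (h x : R^o) <| t |> (h y : R^o) <= h (x <| t |> y)}.

Definition open_cube (R : realType) (n : nat) : set 'rV[R]_n :=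
  [set u | forall i, -1 < u 0 i < 1].
Arguments open_cube : clear implicits.

Definition minkowski_sum (R : realType) (n : nat) (A B : set 'rV[R]_n) :
    set 'rV[R]_n :=
  [set x + y | x in A & y in B].

(* [h] is only meaningful on [K]. For [x] in [K + C_n] the set below is
   nonempty, and it is bounded above when [h] is concave and nonnegative on the
   convex body [K], so [sup] is then a genuine supremum. *)
Definition star_cube (R : realType) (n : nat) (K : set 'rV[R]_n)
    (h : 'rV[R]_n -> R) (x : 'rV[R]_n) : R :=
  sup [set h (x - u) | u in [set u | open_cube R n u /\ K (x - u)]].

(* [discrete_rV R n] is R^n with the power set as sigma-algebra: the lattice
   point enumerator is a measure on all subsets, and with this choice every
   function is measurable (a concave function on a convex body need not be
   Borel measurable, because of its values on the boundary). *)
Definition discrete_rV (R : realType) (n : nat) : Type := 'rV[R]_n.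

HB.instance Definition _ (R : realType) (n : nat) :=
  Pointed.copy (discrete_rV R n) 'rV[R]_n.
HB.instance Definition _ (R : realType) (n : nat) :=
  @isMeasurable.Build default_measure_display (discrete_rV R n)
    discrete_measurable discrete_measurable0
    discrete_measurableC discrete_measurableU.

Definition integer_lattice (R : realType) (n : nat) : set (discrete_rV R n) :=
  [set x : 'rV[R]_n | forall i, x 0 i \is a Num.int].
Arguments integer_lattice : clear implicits.

Lemma measurable_integer_lattice (R : realType) (n : nat) :
  measurable (integer_lattice R n).
Proof. by []. Qed.

(* [lattice_enum R n A = counting (A `&` integer_lattice R n)] *)
Definition lattice_enum (R : realType) (n : nat) :
    set (discrete_rV R n) -> \bar R :=
  mrestr counting (@measurable_integer_lattice R n).
Arguments lattice_enum : clear implicits.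

HB.instance Definition _ (R : realType) (n : nat) :=
  Measure.on (lattice_enum R n).

Definition Gamma (R : realType) (s : R) : R :=
  \int[lebesgue_measure]_(t in `]0, +oo[) (t `^ (s - 1) * expR (- t)).

(* The generalized binomial coefficient "n + p choose n". *)
Definition gbinom (R : realType) (n : nat) (p : R) : R :=
  Gamma (n%:R + p + 1) / (Gamma (n%:R + 1) * Gamma (p + 1)).

(* Main.v *)
Require Import Defs.
From HB Require Import structures.
From mathcomp Require Import all_boot all_order all_algebra.
From mathcomp Require Import all_classical all_reals all_analysis.
From mathcomp Require Import measurable_realfun ring lra.

Set Implicit Arguments.
Unset Strict Implicit.
Unset Printing Implicit Defensive.

Import Order.TTheory GRing.Theory Num.Theory.
Import numFieldNormedType.Exports.

Local Open Scope classical_set_scope.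
Local Open Scope ring_scope.

(* Let N be the number of lattice points of K, F(t) the number of lattice points
   x of K with h x >= t, and G(t) the number of lattice points y of K + C_n with
   (h * chi)(y) >= t.  By the layer-cake formula the two sides are moments of F
   and G.  Concavity of h and the discrete Brunn-Minkowski inequality give, for
   0 < t < t', G(t)^(1/n) >= (1 - t/t') N^(1/n) + (t/t') F(t')^(1/n): once F lies
   above a profile N (1 - t/a)_+^n at t', G lies above it on ]0, t'].  Choosing a
   so that F and the profile have the same q-th moment (a Beta integral, the
   reciprocal of the binomial coefficient), a single-crossing argument compares
   the p-th moments of G and of the profile.

   The discrete Brunn-Minkowski inequality is proved by induction on n through
   sections, comparing the section counts with their maxima (Bonnesen) and
   applying the one-dimensional inequality to their superlevel sets. *)

(** * One-dimensional discrete Brunn-Minkowski inequality *)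

Section IntervalCounting.
Variable R : realType.
Local Notation mu := (@lebesgue_measure R).

Lemma count_natr (I : Type) (P : pred I) (s : seq I) :
  (count P s)%:R = \sum_(i <- s) (P i)%:R :> R.
Proof.
elim: s => [|x s ih] /=; first by rewrite big_nil.
by rewrite big_cons natrD ih.
Qed.

Lemma integral_count_itv (I : Type) (l u : I -> R) (s : seq I) (c : R) :
  0 <= c -> (forall i, l i <= u i) ->
  (\int[mu]_t (c * (count (fun i => l i <= t < u i) s)%:R)%:E =
   (c * \sum_(i <- s) (u i - l i))%:E)%E.
Proof.
move=> c0 lu.
have E t : ((c * (count (fun i => l i <= t < u i) s)%:R)%:E =
    \sum_(i <- s) (c * \1_`[l i, u i[%classic t)%:E)%E.
  rewrite count_natr mulr_sumr sumEFin; congr EFin; apply: eq_bigr => i _.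
  rewrite indicE; congr (_ * _); congr (_%:R); congr nat_of_bool.
  by apply/idP/idP; rewrite inE /= in_itv.
under eq_integral do rewrite E.
have mind i : measurable_fun [set: R]
    (EFin \o (fun t : R => c * \1_`[l i, u i[%classic t)).
  by apply/measurable_EFinP; apply: measurable_funM => //; exact: measurable_indic.
have ind0 i t : (0 <= (c * \1_`[l i, u i[%classic t)%:E)%E.
  by rewrite lee_fin mulr_ge0.
rewrite ge0_integral_sum//.
rewrite mulr_sumr -sumEFin; apply: eq_bigr => i _.
under eq_integral do rewrite EFinM.
rewrite ge0_integralZl//=; last first.
  by apply/measurable_EFinP; exact: measurable_indic.
rewrite integral_indic// setIT.
have /= -> := lebesgue_measure_itv `[l i, u i[; rewrite lte_fin.
have := lu i; rewrite le_eqVlt => /predU1P[->|->].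
  by rewrite ltxx mule0 subrr mulr0.
by rewrite -EFinB -EFinM.
Qed.

Lemma measurable_count_itv (I : Type) (l u : I -> R) (s : seq I) (c : R) :
  measurable_fun [set: R]
    (fun t : R => (c * (count (fun i => l i <= t < u i) s)%:R)%:E).
Proof.
rewrite (_ : (fun _ => _) =
    (fun t => (c * \sum_(i <- s) \1_`[l i, u i[%classic t)%:E)).
  apply/measurable_EFinP; apply: measurable_funM => //.
  by apply: measurable_sum => i; exact: measurable_indic.
apply/funext => t; rewrite count_natr; congr (_ * _)%:E; apply: eq_bigr => i _.
rewrite indicE; congr (_%:R); congr nat_of_bool.
by apply/idP/idP; rewrite inE /= in_itv.
Qed.

(** Integrating over [t] replaces the number of intervals covering [t] by their total length. It
    serves twice: for translates of fixed length attached to integers, and for intervals starting at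
    0 as a layer-cake formula. *)
Lemma count_itv_le (I J L : Type) (s1 : seq I) (s2 : seq J) (s3 : seq L)
    (l1 u1 : I -> R) (l2 u2 : J -> R) (l3 u3 : L -> R) (c1 c2 c3 : R) :
  0 <= c1 -> 0 <= c2 -> 0 <= c3 ->
  (forall i, l1 i <= u1 i) -> (forall i, l2 i <= u2 i) ->
  (forall i, l3 i <= u3 i) ->
  (forall t, c1 * (count (fun i => l1 i <= t < u1 i) s1)%:R
           + c2 * (count (fun i => l2 i <= t < u2 i) s2)%:R
          <= c3 * (count (fun i => l3 i <= t < u3 i) s3)%:R) ->
  c1 * (\sum_(i <- s1) (u1 i - l1 i)) + c2 * (\sum_(i <- s2) (u2 i - l2 i))
  <= c3 * \sum_(i <- s3) (u3 i - l3 i).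
Proof.
move=> c10 c20 c30 lu1 lu2 lu3 H.
rewrite -lee_fin EFinD -!integral_count_itv//.
rewrite -ge0_integralD//; last 4 first.
- by move=> t _; rewrite lee_fin mulr_ge0.
- exact: measurable_count_itv.
- by move=> t _; rewrite lee_fin mulr_ge0.
- exact: measurable_count_itv.
apply: ge0_le_integral => //.
- by move=> t _; rewrite -EFinD lee_fin addr_ge0// mulr_ge0.
- by apply: emeasurable_funD; exact: measurable_count_itv.
- exact: measurable_count_itv.
- by move=> t _; rewrite -EFinD lee_fin.
Qed.

Lemma count_le1 (T : eqType) (P : pred T) (s : seq T) : uniq s ->
  {in s &, forall x y, P x -> P y -> x = y} -> (count P s <= 1)%N.
Proof.
elim: s => [//|x s ih] /= /andP[xs us] H.
case: (boolP (P x)) => Px /=; last first.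
  apply: ih => // y z ys zs; apply: H; rewrite inE ?ys ?zs orbT//.
rewrite (_ : count P s = 0%N)//; apply/eqP; rewrite -leqn0 leqNgt -has_count.
apply/hasPn => y ys; apply/negP => Py.
by move: xs; rewrite (H x y) ?mem_head ?ys// inE ys orbT.
Qed.

Lemma seq_argmax (T : eqType) (f : T -> R) (s : seq T) : s != [::] ->
  exists2 x, x \in s & {in s, forall y, f y <= f x}.
Proof.
elim: s => [//|x s ih] _; case: (eqVneq s [::]) => [->|/ih[y ys Hy]].
  by exists x; rewrite ?mem_head// => y; rewrite inE => /eqP->.
case: (leP (f y) (f x)) => xy.
  exists x; rewrite ?mem_head// => z; rewrite inE => /predU1P[->//|/Hy].
  by move=> /le_trans; exact.
exists y; first by rewrite inE ys orbT.
by move=> z; rewrite inE => /predU1P[->|/Hy//]; exact: ltW.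
Qed.

Lemma intr_lt1_eq (a b : R) : a \is a Num.int -> b \is a Num.int ->
  a < b + 1 -> b < a + 1 -> a = b.
Proof.
move=> /intrP[m ->] /intrP[k ->]; rewrite -(intrD _ k 1) -(intrD _ m 1) !ltr_int.
by rewrite !ltzD1 => mk km; congr (_%:~R); apply/eqP; rewrite eq_le mk km.
Qed.

(** Used in both orders together with [intr_lt1_eq]: it makes the intervals of length [c] attached
    to distinct integers disjoint. *)
Lemma lt_nmul_itv (x a b c : R) : 0 < c -> a * c <= x < a * c + c ->
  b * c <= x < b * c + c -> a < b + 1.
Proof.
move=> c0 /andP[ax _] /andP[_ xb].
rewrite -(ltr_pM2r c0) mulrDl mul1r; exact: le_lt_trans xb.
Qed.

(* [A + [0, 1)] and [B + [0, 1)], scaled and placed one after the other, fill a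
   set of measure [(1 - l) #|A| + l #|B|] whose points have their floor in [C] *)
Lemma discrete_brunn_minkowski1 (l : R) (A B C : seq R) :
  0 < l < 1 -> uniq A -> uniq B -> A != [::] -> B != [::] ->
  {in A, forall a, a \is a Num.int} -> {in B, forall b, b \is a Num.int} ->
  (forall a b z, a \in A -> b \in B -> z \is a Num.int ->
     `|z - ((1 - l) * a + l * b)| < 1 -> z \in C) ->
  (1 - l) * (size A)%:R + l * (size B)%:R <= (size C)%:R.
Proof.
move=> /andP[l0 l1] uA uB A0 B0 iA iB H.
have l1' : 0 < 1 - l by rewrite subr_gt0.
have [a1 a1A Ha1] := seq_argmax (fun x : R => x) A0.
have [b0 b0B Hb0] := seq_argmax (fun x : R => - x) B0.
have {}Hb0 y : y \in B -> b0 <= y by move/Hb0; rewrite lerN2.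
(* The copy of [A] is attached to the minimum [b0] of [B] and ends at [(a1 + 1) * (1 - l) + l * b0].
   The copy of [B] is attached to the maximum [a1] of [A] and starts there, so the two are
   disjoint. *)
pose p (a : R) : R := a * (1 - l) + l * b0.
pose q (b : R) : R := b * l + (a1 + 1) * (1 - l).
have := @count_itv_le R R R A B C p (fun a => p a + (1 - l)) q
  (fun b => q b + l) id (fun z => z + 1) 1 1 1.
have D (s : seq R) (f : R -> R) c :
    \sum_(i <- s) (f i + c - f i) = c * (size s)%:R.
  under eq_bigr do rewrite addrAC subrr add0r.
  by rewrite big_const_seq count_predT iter_addr_0 mulr_natr.
rewrite (D A p) (D B q) (D C id) !mul1r; apply => //.
- by move=> a; rewrite lerDl ltW.
- by move=> a; rewrite lerDl ltW.
- by move=> a; rewrite lerDl.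
move=> w; rewrite !mul1r -natrD ler_nat.
have cA : (count (fun i => p i <= w < p i + (1 - l))%R A <= 1)%N.
  apply: count_le1 => // x y xA yA; rewrite /p => Hx Hy.
  apply: intr_lt1_eq; rewrite ?iA//;
    by apply: (@lt_nmul_itv (w - l * b0) _ _ (1 - l)) => //; lra.
have cB : (count (fun i => q i <= w < q i + l)%R B <= 1)%N.
  apply: count_le1 => // x y xA yA; rewrite /q => Hx Hy.
  apply: intr_lt1_eq; rewrite ?iB//;
    by apply: (@lt_nmul_itv (w - (a1 + 1) * (1 - l)) _ _ l) => //; lra.
(* In either copy [w] exceeds the relevant combination [(1 - l) * a + l * b] by an amount in [0, 1[.
   The floor of [w] lies in ]w - 1, w], hence at distance less than 1 from that combination, and so
   belongs to [C]. *)
have fw : (Num.floor w)%:~R <= w < (Num.floor w)%:~R + 1.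
  by have := floor_itv w; rewrite intrD.
have floorC : ((Num.floor w)%:~R \in C) ->
    (0 < count (fun z : R => z <= w < z + 1)%R C)%N.
  by move=> wC; rewrite -has_count; apply/hasP; exists (Num.floor w)%:~R.
case: (boolP (has (fun i => p i <= w < p i + (1 - l))%R A)) => hA.
  have /hasP[a aA wa] := hA.
  have -> : count (fun i => q i <= w < q i + l)%R B = 0%N.
    apply/eqP; rewrite -leqn0 leqNgt -has_count; apply/hasPn => b bB.
    have aa1 : a * (1 - l) <= a1 * (1 - l) by rewrite ler_pM2r// Ha1.
    have bb0 : b0 * l <= b * l by rewrite ler_pM2r// Hb0.
    by move: wa; rewrite /p /q => wa; apply/negP => wb; lra.
  rewrite addn0; apply: (leq_trans cA); apply: floorC.
  apply: (H a b0) => //.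
  by rewrite ltr_norml; move: wa; rewrite /p => wa; apply/andP; split; lra.
move: hA; rewrite has_count -leqNgt leqn0 => /eqP->; rewrite add0n.
case: (boolP (has (fun i => q i <= w < q i + l)%R B)) => hB; last first.
  by move: hB; rewrite has_count -leqNgt leqn0 => /eqP->.
have /hasP[b bB wb] := hB.
apply: (leq_trans cB); apply: floorC.
apply: (H a1 b) => //.
by rewrite ltr_norml; move: wb; rewrite /q => wb; apply/andP; split; lra.
Qed.

End IntervalCounting.

(** * Discrete Brunn-Minkowski inequality *)

Section BrunnMinkowski.
Variable R : realType.

(** A convex power lies above its tangent at [m]. Multiplying the induction hypothesis by [x] leaves
    the defect [k * y * (x - m) ^+ 2]. *)
Lemma exprS_tangent (n : nat) (m x : R) : 0 <= m -> 0 <= x ->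
  m ^+ n.+1 + n.+1%:R * m ^+ n * (x - m) <= x ^+ n.+1.
Proof.
move=> m0 x0; elim: n => [|n ih]; first by rewrite expr0 !expr1; lra.
rewrite [x ^+ _]exprS; apply: le_trans (ler_wpM2l x0 ih).
rewrite -subr_ge0 -[n.+2%:R]natr1 [m ^+ n.+2]exprS [m ^+ n.+1]exprS.
set k := n.+1%:R; set y := m ^+ n.
rewrite (_ : _ - _ = k * y * (x - m) ^+ 2); last by ring.
by rewrite mulr_ge0 ?sqr_ge0// mulr_ge0// exprn_ge0.
Qed.

(* Jensen's inequality for [x ^+ n.+1] at the points [r / a] and [s / b], with
   weights proportional to [(1 - l) * a] and [l * b] *)
Lemma exprS_conv_le (n : nat) (l a b r s : R) : 0 < l < 1 -> 0 < a -> 0 < b ->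
  0 <= r -> 0 <= s ->
  ((1 - l) * r + l * s) ^+ n.+1 <= ((1 - l) * a + l * b) ^+ n *
    ((1 - l) * (r ^+ n.+1 / a ^+ n) + l * (s ^+ n.+1 / b ^+ n)).
Proof.
move=> /andP[l0 l1] a0 b0 r0 s0.
have l1' : 0 < 1 - l by rewrite subr_gt0.
set m := (1 - l) * a + l * b; set S := (1 - l) * r + l * s.
have m0 : 0 < m by rewrite addr_gt0// mulr_gt0.
have S0 : 0 <= S by rewrite addr_ge0// mulr_ge0// ltW.
(* The weighted mean of [r / a] and [s / b]: the linear terms of the tangents at this point cancel
   in the weighted sum. *)
pose u := S / m.
have u0 : 0 <= u by rewrite divr_ge0// ltW.
have Eq (x c : R) : 0 < c -> x ^+ n.+1 / c ^+ n = c * (x / c) ^+ n.+1.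
  by move=> c0; rewrite expr_div_n [c ^+ n.+1]exprS; field; rewrite expf_neq0 !gt_eqF.
rewrite (Eq r)// (Eq s)//.
have -> : S ^+ n.+1 = m ^+ n * (m * u ^+ n.+1).
  by rewrite mulrA -exprSr -exprMn /u mulrC divfK// gt_eqF.
apply: ler_wpM2l; first by rewrite exprn_ge0// ltW.
have T1 := exprS_tangent n u0 (divr_ge0 r0 (ltW a0)).
have T2 := exprS_tangent n u0 (divr_ge0 s0 (ltW b0)).
have W1 : 0 <= (1 - l) * a by rewrite mulr_ge0// ltW.
have W2 : 0 <= l * b by rewrite mulr_ge0// ltW.
have := lerD (ler_wpM2l W1 T1) (ler_wpM2l W2 T2).
rewrite !mulrA; apply: le_trans; rewrite le_eqVlt; apply/orP; left; apply/eqP.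
rewrite -!mulrA.
have D1 : a * (r / a) = r by rewrite mulrC divfK// gt_eqF.
have D2 : b * (s / b) = s by rewrite mulrC divfK// gt_eqF.
have D3 : m * u = S by rewrite mulrC divfK// gt_eqF.
set x := r / a in D1 *; set y := s / b in D2 *.
rewrite !mulrDr -!addrA; set U := u ^+ n.+1; set V := u ^+ n; set k := n.+1%:R.
have : (1 - l) * (a * x) + l * (b * y) = m * u by rewrite D1 D2 D3.
rewrite /m => H.
transitivity (((1 - l) * a + l * b) * U + k * V *
   ((1 - l) * (a * x) + l * (b * y) - ((1 - l) * a + l * b) * u)); last by ring.
by rewrite H subrr mulr0 addr0.
Qed.

(* Both functions are compared with their maxima [a ^+ n] and [b ^+ n], so that
   all superlevel sets [f > t * a ^+ n] and [g > t * b ^+ n], [0 <= t < 1], are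
   nonempty and the one-dimensional inequality applies to them. *)
Lemma discrete_borell_brascamp_lieb1 (n : nat) (l a b : R) (X Y Z : seq R)
    (f g k : R -> R) :
  0 < l < 1 -> uniq X -> uniq Y -> 0 < a -> 0 < b ->
  {in X, forall x, x \is a Num.int} -> {in Y, forall y, y \is a Num.int} ->
  (exists2 x, x \in X & f x = a ^+ n) -> (exists2 y, y \in Y & g y = b ^+ n) ->
  (forall x, 0 <= f x <= a ^+ n) -> (forall y, 0 <= g y <= b ^+ n) ->
  (forall z, 0 <= k z) ->
  (forall x y z t, x \in X -> y \in Y -> z \is a Num.int ->
     `|z - ((1 - l) * x + l * y)| < 1 -> 0 < t <= 1 ->
     t * a ^+ n <= f x -> t * b ^+ n <= g y ->
     z \in Z /\ t * ((1 - l) * a + l * b) ^+ n <= k z) ->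
  ((1 - l) * a + l * b) ^+ n *
    ((1 - l) * ((\sum_(x <- X) f x) / a ^+ n)
      + l * ((\sum_(y <- Y) g y) / b ^+ n))
  <= \sum_(z <- Z) k z.
Proof.
move=> /andP[l0 l1] uX uY a0 b0 iX iY [x0 x0X fx0] [y0 y0Y gy0] f0 g0 k0 H.
have l1' : 0 < 1 - l by rewrite subr_gt0.
set M := ((1 - l) * a + l * b) ^+ n.
have M0 : 0 < M by rewrite exprn_gt0// addr_gt0// mulr_gt0.
have an0 : 0 < a ^+ n by rewrite exprn_gt0.
have bn0 : 0 < b ^+ n by rewrite exprn_gt0.
rewrite mulrC -ler_pdivlMr//.
(* Layer-cake formula: the interval [0, f x / a^n[ covers a given t >= 0 exactly when f x > t
   a^n. *)
have := @count_itv_le R R R R X Y Z (fun=> 0) (fun x => f x / a ^+ n)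
  (fun=> 0) (fun y => g y / b ^+ n) (fun=> 0) (fun z => k z / M) (1 - l) l 1.
have D (s : seq R) (h : R -> R) c :
    \sum_(i <- s) (h i / c - 0) = (\sum_(i <- s) h i) / c.
  by under eq_bigr do rewrite subr0; rewrite mulr_suml.
rewrite !D mul1r; apply => //.
- exact: ltW.
- exact: ltW.
- by move=> x; rewrite divr_ge0// ?(ltW an0)//; case/andP: (f0 x).
- by move=> x; rewrite divr_ge0// ?(ltW bn0)//; case/andP: (g0 x).
- by move=> x; rewrite divr_ge0// ltW.
move=> t; rewrite mul1r.
case: (leP 0 t) => [t0|t0]; last by rewrite !count_pred0 !mulr0 addr0.
case: (ltP t 1) => [t1|t1]; last first.
  rewrite (eq_count (a2 := pred0)); last first.
    move=> x /=; apply/negbTE; rewrite -leNgt (le_trans _ t1)//.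
    by rewrite ler_pdivrMr// mul1r; case/andP: (f0 x).
  rewrite [X in _ + _ * X%:R](eq_count (a2 := pred0)); last first.
    move=> x /=; apply/negbTE; rewrite -leNgt (le_trans _ t1)//.
    by rewrite ler_pdivrMr// mul1r; case/andP: (g0 x).
  by rewrite !count_pred0 !mulr0 addr0.
rewrite -!size_filter; apply: discrete_brunn_minkowski1.
- by rewrite l0.
- exact: filter_uniq.
- exact: filter_uniq.
- rewrite -has_filter; apply/hasP; exists x0 => //=.
  by rewrite fx0 divff ?gt_eqF.
- rewrite -has_filter; apply/hasP; exists y0 => //=.
  by rewrite gy0 divff ?gt_eqF.
- by move=> x; rewrite mem_filter => /andP[_]; exact: iX.
- by move=> x; rewrite mem_filter => /andP[_]; exact: iY.
move=> x y z; rewrite !mem_filter /= => /andP[tx xX] /andP[ty yY] zi xyz.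
(* The superlevel sets are strict while the hypothesis uses [<=]. The smaller normalised value is a
   common level strictly above [t], which gives back a strict inequality for [k z]. *)
pose u := Num.min (f x / a ^+ n) (g y / b ^+ n).
have tu : t < u by rewrite lt_min tx ty.
have ua : u * a ^+ n <= f x by rewrite -ler_pdivlMr// ge_min lexx.
have ub : u * b ^+ n <= g y by rewrite -ler_pdivlMr// ge_min lexx orbT.
have u1 : u <= 1.
  by rewrite ge_min ler_pdivrMr// mul1r; case/andP: (f0 x) => _ ->.
have u01 : 0 < u <= 1 by rewrite u1 andbT; exact: le_lt_trans tu.
have [zZ uk] := H x y z u xX yY zi xyz u01 ua ub.
by rewrite zZ andbT (lt_le_trans tu)// ler_pdivlMr.
Qed.

(** Double counting: each [y] in [s] is counted once, at the value [h y]. With [h := vhead], the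
    section sizes add up to the size of the list. *)
Lemma sum_count_undup (T U : eqType) (h : T -> U) (s : seq T) :
  (\sum_(x <- undup (map h s)) count (fun y => h y == x) s)%N = size s.
Proof.
under eq_bigr do rewrite -sum1_count big_mkcond.
rewrite exchange_big /= big_seq_cond.
under eq_bigr => y /andP[ys _].
  rewrite -big_mkcond /= sum1_count (eq_count (a2 := pred1 (h y))); last first.
    by move=> x /=; rewrite eq_sym.
  rewrite count_uniq_mem ?undup_uniq// mem_undup map_f//; over.
by rewrite -big_seq_cond big_const_seq count_predT iter_addn mul1n addn0.
Qed.

(** * Sections of a finite point set along the first coordinate *)

Definition vhead (n : nat) (x : 'rV[R]_n.+1) : R := x 0 ord0.
Definition vtail (n : nat) (x : 'rV[R]_n.+1) : 'rV[R]_n :=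
  \row_i x 0 (lift ord0 i).
Definition vcons (n : nat) (c : R) (x : 'rV[R]_n) : 'rV[R]_n.+1 :=
  \row_i (if unlift ord0 i is Some j then x 0 j else c).

Lemma vhead_cons n c (x : 'rV[R]_n) : vhead (vcons c x) = c.
Proof. by rewrite /vhead mxE unlift_none. Qed.

Lemma vtail_cons n c (x : 'rV[R]_n) : vtail (vcons c x) = x.
Proof. by apply/rowP => i; rewrite !mxE liftK. Qed.

Lemma vtail_inj n (x y : 'rV[R]_n.+1) :
  vhead x = vhead y -> vtail x = vtail y -> x = y.
Proof.
move=> h /rowP t; apply/rowP => i; case: (unliftP ord0 i) => [j ->|-> //].
by have := t j; rewrite !mxE.
Qed.

Definition section n (A : seq 'rV[R]_n.+1) (c : R) : seq 'rV[R]_n :=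
  [seq vtail x | x <- A & vhead x == c].

Lemma size_section n (A : seq 'rV[R]_n.+1) c :
  size (section A c) = count (fun x => vhead x == c) A.
Proof. by rewrite size_map size_filter. Qed.

Lemma uniq_section n (A : seq 'rV[R]_n.+1) c : uniq A -> uniq (section A c).
Proof.
move=> uA; rewrite map_inj_in_uniq ?filter_uniq// => x y.
rewrite !mem_filter => /andP[/eqP xc _] /andP[/eqP yc _].
by apply: vtail_inj; rewrite xc yc.
Qed.

Lemma mem_section n (A : seq 'rV[R]_n.+1) c x :
  x \in section A c -> vcons c x \in A.
Proof.
case/mapP => y; rewrite mem_filter => /andP[/eqP yc yA] ->.
rewrite (_ : vcons _ _ = y)//.
by apply: vtail_inj; rewrite ?vhead_cons ?vtail_cons.
Qed.

Lemma section_mem n (A : seq 'rV[R]_n.+1) c x :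
  vcons c x \in A -> x \in section A c.
Proof.
move=> cx; apply/mapP; exists (vcons c x); last by rewrite vtail_cons.
by rewrite mem_filter vhead_cons eqxx.
Qed.

(** For n = 0 every [r ^+ 0] is 1, which agrees with the size because R^0 has a single point and [s]
    has no repetition. For n > 0 a real root is taken. *)
Lemma root_size_rV n (s : seq 'rV[R]_n) : uniq s -> s != [::] ->
  exists2 r : R, 0 < r & r ^+ n = (size s)%:R.
Proof.
move=> us s0; have s1 : (0 < size s)%N by rewrite lt0n size_eq0.
case: n s us s0 s1 => [|n] s us s0 s1.
  exists 1 => //; rewrite expr0; apply/esym/eqP; rewrite pnatr_eq1 eqn_leq s1.
  rewrite andbT; move: us; case: s {s0 s1} => [|u [|v s]]//=.
  by rewrite (_ : u = v) ?mem_head// !thinmx0.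
exists ((size s)%:R `^ n.+1%:R^-1); first by rewrite powR_gt0// ltr0n.
by rewrite -powR_mulrn ?powR_ge0// -powRrM mulVf ?powRr1.
Qed.

(** The fullest section supplies the maximum [a ^+ n] used for normalisation. A value that is the
    head of no point has an empty section, so the bound extends to every [x]. *)
Lemma max_section_root n (A : seq 'rV[R]_n.+1) : uniq A -> A != [::] ->
  exists2 a : R, 0 < a & (exists2 x, x \in undup (map (@vhead n) A) &
     (size (section A x))%:R = a ^+ n :> R) /\
   forall x, (size (section A x))%:R <= a ^+ n :> R.
Proof.
move=> uA A0; have hA0 : undup (map (@vhead n) A) != [::].
  case: A A0 {uA} => // x s _; apply/eqP => E.
  by have := mem_head (vhead x) (map (@vhead n) s); rewrite -mem_undup E.
have [x xA Hx] := @seq_argmax R _ (fun c => (size (section A c))%:R) _ hA0.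
have {}Hx y : (size (section A y))%:R <= (size (section A x))%:R :> R.
  have [yA|] := boolP (y \in undup (map (@vhead n) A)); first exact: Hx.
  rewrite mem_undup => yA; rewrite (_ : size (section A y) = 0%N)//.
  rewrite size_section; apply/eqP; rewrite -leqn0 leqNgt -has_count.
  by apply: contra yA => /hasP[z zA /eqP<-]; rewrite map_f.
have xpos : (0 < size (section A x))%N.
  rewrite size_section -has_count; apply/hasP.
  move: xA; rewrite mem_undup => /mapP[z zA ->].
  by exists z => /=.
have sx0 : section A x != [::] by rewrite -size_eq0 -lt0n.
have [a a0 aE] := root_size_rV (uniq_section x uA) sx0.
by exists a => //; rewrite aE; split => //; exists x.
Qed.

(* An [n]-th root of [t]; for [n = 0] only [1] is available, and the counts
   being positive integers is what makes it work. *)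
Lemma level_root (n k m : nat) (t a b : R) : 0 < t -> t <= 1 ->
  (0 < k)%N -> (0 < m)%N -> t * a ^+ n <= k%:R -> t * b ^+ n <= m%:R ->
  exists w : R, [/\ 0 <= w, t <= w ^+ n, w ^+ n * a ^+ n <= k%:R
    & w ^+ n * b ^+ n <= m%:R].
Proof.
move=> t0 t1 k0 m0; case: n => [|n] ta tb.
  by exists 1; rewrite !expr0 mulr1 !ler1n.
exists (t `^ n.+1%:R^-1); rewrite powR_ge0.
by rewrite -powR_mulrn ?powR_ge0// -powRrM mulVf// powRr1// ltW.
Qed.

Theorem discrete_brunn_minkowski (n : nat) (l : R) (A B C : seq 'rV[R]_n)
    (r s : R) :
  0 < l < 1 -> uniq A -> uniq B -> A != [::] -> B != [::] ->
  {in A, forall a : 'rV[R]_n, forall i, a 0 i \is a Num.int} ->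
  {in B, forall b : 'rV[R]_n, forall i, b 0 i \is a Num.int} ->
  (forall a b z : 'rV[R]_n, a \in A -> b \in B ->
     (forall i, z 0 i \is a Num.int) ->
     (forall i, `|z 0 i - ((1 - l) * a 0 i + l * b 0 i)| < 1) -> z \in C) ->
  0 <= r -> 0 <= s -> r ^+ n <= (size A)%:R -> s ^+ n <= (size B)%:R ->
  ((1 - l) * r + l * s) ^+ n <= (size C)%:R.
Proof.
move=> l01; elim: n A B C r s => [|n ih] A B C r s uA uB A0 B0 iA iB H r0 s0 rA sB.
  rewrite expr0 ler1n.
  case: A B A0 B0 uA uB iA iB H {rA sB} => // a A [//|b B] _ _ _ _ _ _ H.
  have := H a b 0 (mem_head _ _) (mem_head _ _).
  by case: C {H} => // /(_ (fun=> _)) H; have := H _ _; rewrite in_nil; apply; case.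
have [l0 l1] := andP l01; have l1' : 0 < 1 - l by rewrite subr_gt0.
have [a a0 [aX fa]] := max_section_root uA A0.
have [b b0 [bY gb]] := max_section_root uB B0.
have sumE (D : seq 'rV[R]_n.+1) : \sum_(x <- undup (map (@vhead n) D))
    (size (section D x))%:R = (size D)%:R :> R.
  rewrite -(sum_count_undup (@vhead n) D) natr_sum.
  by apply: eq_bigr => x _; rewrite size_section.
(* Jensen's inequality leaves the normalised sizes of [A] and [B]. These are sums of section sizes,
   to which the one-dimensional functional inequality applies. *)
apply: le_trans (exprS_conv_le n l01 a0 b0 r0 s0) _.
rewrite -(sumE C).
apply: le_trans (@discrete_borell_brascamp_lieb1 n l a b
  (undup (map (@vhead n) A)) (undup (map (@vhead n) B)) _
  (fun x => (size (section A x))%:R) (fun x => (size (section B x))%:R) _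
  l01 (undup_uniq _) (undup_uniq _) a0 b0 _ _ aX bY _ _ _ _).
- rewrite !sumE; apply: ler_wpM2l.
    by rewrite exprn_ge0// ltW// addr_gt0// mulr_gt0.
  apply: lerD; (apply: ler_wpM2l; first exact: ltW);
    by apply: ler_wpM2r => //; rewrite invr_ge0 exprn_ge0// ltW.
- by move=> x; rewrite mem_undup => /mapP[y yA ->]; exact: iA.
- by move=> x; rewrite mem_undup => /mapP[y yA ->]; exact: iB.
- by move=> x; rewrite fa andbT.
- by move=> x; rewrite gb andbT.
- by [].
move=> x y z t xX yY zi xyz /andP[t0 t1] tf tg.
have sA : (0 < size (section A x))%N.
  rewrite -(ltr0n R) (lt_le_trans _ tf)//.
  by rewrite mulr_gt0// exprn_gt0.
have sB' : (0 < size (section B y))%N.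
  rewrite -(ltr0n R) (lt_le_trans _ tg)//.
  by rewrite mulr_gt0// exprn_gt0.
have [w [w0 wt wA wB]] := level_root t0 t1 sA sB' tf tg.
(* The induction hypothesis is used with the scaled roots [w * a] and [w * b], so that a common
   factor [w ^+ n], at least [t], comes out of the combination. *)
have HC : t * ((1 - l) * a + l * b) ^+ n <= (size (section C z))%:R.
  have := ih (section A x) (section B y) (section C z) (w * a) (w * b)
    (uniq_section x uA) (uniq_section y uB).
  rewrite -!size_eq0 -!lt0n => /(_ sA sB').
  rewrite !exprMn => /(_ _ _ _ _ _ wA wB).
  have -> : (1 - l) * (w * a) + l * (w * b) = w * ((1 - l) * a + l * b).
    by ring.
  rewrite exprMn => H'; apply: le_trans; last apply: H'.
  - by apply: ler_wpM2r => //; rewrite exprn_ge0// ltW// addr_gt0// mulr_gt0.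
  - move=> u /mem_section/iA iu i; have := iu (lift ord0 i).
    by rewrite mxE liftK.
  - move=> u /mem_section/iB iu i; have := iu (lift ord0 i).
    by rewrite mxE liftK.
  - move=> u v c /mem_section uu /mem_section vv ci Hc.
    apply: section_mem; apply: H uu vv _ _ => i; rewrite !mxE.
      by case: unliftP.
    by case: unliftP.
  - by rewrite mulr_ge0// ltW.
  - by rewrite mulr_ge0// ltW.
split => //; rewrite mem_undup.
(* The lower bound just obtained is positive, so the section is nonempty and [z] is the head of a
   point of [C]. *)
have : (0 < size (section C z))%N.
  rewrite -(ltr0n R) (lt_le_trans _ HC)// mulr_gt0// exprn_gt0//.
  by rewrite addr_gt0// mulr_gt0.
by rewrite size_section -has_count => /hasP[c cC /eqP<-]; rewrite map_f.
Qed.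

End BrunnMinkowski.

(** * Beta integrals *)

Section Integrals.
Variable R : realType.
Local Notation mu := (@lebesgue_measure R).

Lemma continuous_pos_measurable (f : R -> R) :
  (forall x : R, 0 < x -> {for x, continuous f}) ->
  measurable_fun (`]0, +oo[%classic : set R) f.
Proof.
move=> cf; apply: open_continuous_measurable_fun; first exact: interval_open.
by move=> x; rewrite inE/= in_itv/= andbT; exact: cf.
Qed.

(** The integrand may blow up at 0, as t^(p - 1) does for p < 1. The fundamental theorem is applied
    on [1/(n+1), a], and monotone convergence passes to the limit. *)
Lemma ge0_FTC_oc (f F : R -> R) (a : R) : 0 < a ->
  (forall x : R, 0 < x -> {for x, continuous f}) ->
  (forall x : R, 0 < x -> is_derive x 1 F (f x)) ->
  (forall x : R, 0 < x <= a -> 0 <= f x) ->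
  F x @[x --> 0^'+] --> F 0 ->
  (\int[mu]_(x in `]0%R, a]) (f x)%:E = (F a - F 0)%:E)%E.
Proof.
move=> a0 cf dF f0 F0.
have cF (x : R) : 0 < x -> {for x, continuous F}.
  move=> /dF Fx; apply: differentiable_continuous.
  by apply/derivable1_diffP; exact: ex_derive.
have mf : measurable_fun (`]0, +oo[%classic : set R) f.
  exact: continuous_pos_measurable.
have FTC c : 0 < c < a ->
    (\int[mu]_(x in `[c, a]) (f x)%:E = (F a - F c)%:E)%E.
  move=> /andP[c0 ca]; rewrite EFinB; apply: continuous_FTC2 => //.
  - apply: continuous_in_subspaceT => x; rewrite inE/= in_itv/= => /andP[cx _].
    by apply: cf; exact: lt_le_trans cx.
  - split.
    + move=> x; rewrite in_itv/= => /andP[cx _].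
      by have := dF x (lt_trans c0 cx) => Fx; exact: ex_derive.
    + by apply: cvg_at_right_filter; exact: cF.
    + by apply: cvg_at_left_filter; exact: cF.
  - move=> x; rewrite in_itv/= => /andP[cx _]; rewrite derive1E.
    by have := dF x (lt_trans c0 cx) => Fx; exact: derive_val.
rewrite itv_open_bnd_bigcup.
pose D (n : nat) : set R := `[0 + n.+1%:R^-1, a]%classic.
have C1 : (\int[mu]_(x in D n) (f x)%:E)%E @[n --> \oo] -->
    (\int[mu]_(x in \bigcup_n D n) (f x)%:E)%E.
  apply: ge0_nondecreasing_set_cvg_integral.
  - move=> m n mn; rewrite subsetEset; apply: subset_itvr.
    by rewrite bnd_simp !add0r lef_pV2 ?posrE// ler_nat.
  - by move=> n; exact: measurable_itv.
  - move=> n; apply/measurable_EFinP; apply: measurable_funS mf => //.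
    move=> x; rewrite /D/= !in_itv/= andbT add0r => /andP[nx _].
    by apply: lt_le_trans nx.
  - move=> n x; rewrite /D/= in_itv/= add0r => /andP[nx xa].
    by rewrite lee_fin f0// xa andbT; apply: lt_le_trans nx.
have C2 : (\int[mu]_(x in D n) (f x)%:E)%E @[n --> \oo] --> (F a - F 0)%:E.
  apply: (@cvg_trans _ ((F a - F (n.+1%:R^-1))%:E @[n --> \oo])).
    apply: near_eq_cvg; near=> n; rewrite /D add0r FTC// invr_gt0 ltr0n/=.
    by near: n; exact: near_infty_natSinv_lt (PosNum a0).
  apply: cvg_EFin; first exact: nearW.
  apply: cvgB; first exact: cvg_cst.
  move/cvg_at_rightP : F0; apply; split; last exact: cvg_harmonic.
  by move=> n; rewrite invr_gt0.
exact: cvg_unique C1 C2.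
Unshelve. all: by end_near. Qed.


Lemma powR_continuous_pos (p x : R) : 0 < x ->
  {for x, continuous (fun t : R => t `^ p)}.
Proof.
move=> x0; apply: differentiable_continuous; apply/derivable1_diffP.
by apply: derivable_powR; rewrite in_itv/= andbT.
Qed.

Lemma integral_powR_oc (p c : R) : 0 < p -> 0 <= c ->
  (\int[mu]_(t in `]0%R, c]) (p * t `^ (p - 1))%:E = (c `^ p)%:E)%E.
Proof.
move=> p0; rewrite le_eqVlt => /predU1P[<-|c0].
  by rewrite set_itvoc0 integral_set0 powR0// gt_eqF.
rewrite (@ge0_FTC_oc _ (fun t => t `^ p))//.
- by rewrite powR0 ?gt_eqF// subr0.
- move=> x x0; apply: continuousM; first exact: cvg_cst.
  exact: powR_continuous_pos.
- by move=> x _; rewrite mulr_ge0 ?powR_ge0// ltW.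
- by rewrite powR0 ?gt_eqF//; exact: powR_cvg0.
Qed.

(* an antiderivative of [p * t `^ (p - 1) * (1 - t / a) ^+ n], by iterated
   integration by parts *)
Fixpoint beta_primitive (a : R) (n : nat) (p t : R) : R :=
  if n is m.+1 then
    t `^ p * (1 - t / a) ^+ n
      + n%:R / ((p + 1) * a) * beta_primitive a m (p + 1) t
  else t `^ p.

Lemma is_derive_beta_primitive (a : R) (n : nat) (p x : R) :
  0 < a -> 0 < p -> 0 < x ->
  is_derive x 1 (beta_primitive a n p)
    (p * x `^ (p - 1) * (1 - x / a) ^+ n).
Proof.
move=> a0 + x0; elim: n p => [|n ih] p p0 /=.
  by rewrite mulr1; exact: is_derive1_powR.
have p10 : 0 < p + 1 by rewrite addr_gt0.
have d1 : is_derive x 1 (fun t : R => t `^ p) (p * x `^ (p - 1)).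
  exact: is_derive1_powR.
have d2 : is_derive x 1 (fun t : R => 1 - t / a) (- a^-1).
  by apply: is_derive_eq; rewrite ?scaler0 ?add0r mul1r /GRing.scale/= mulr1.
have d3 := is_deriveX n.+1 d2.
have d4 := is_deriveM d1 d3.
have d5 := is_deriveZ (n.+1%:R / ((p + 1) * a)) (ih (p + 1) p10).
have d6 := is_deriveD d4 d5.
rewrite (_ : (fun t => _) = (fun t : R => t `^ p) * (fun t => 1 - t / a) ^+ n.+1
    + (n.+1%:R / ((p + 1) * a)) \*: beta_primitive a n (p + 1)); last first.
  by apply/funext => t; rewrite !fctE.
apply: (is_derive_eq d6).
rewrite !fctE /GRing.scale/= addrK.
set u := (1 - x / a) ^+ n.+1; set v := (1 - x / a) ^+ n; set k := n.+1%:R.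
by field; rewrite !gt_eqF.
Qed.

(** Product form of the binomial coefficient of n + p over n; [gbinomE] identifies it with the Gamma
    quotient. *)
Definition beta_coef (n : nat) (p : R) : R :=
  \prod_(i < n) ((p + i.+1%:R) / i.+1%:R).

Lemma beta_coef_gt0 n p : 0 < p -> 0 < beta_coef n p.
Proof.
by move=> p0; apply: prodr_gt0 => i _; rewrite divr_gt0// ltr_wpDr.
Qed.

(** The factors p + 1 of the numerator and n + 1 of the denominator are split off. The shift from
    [p] to [p + 1] matches the recursion of [beta_primitive]. *)
Lemma beta_coefS n p :
  beta_coef n.+1 p = (p + 1) / n.+1%:R * beta_coef n (p + 1).
Proof.
elim: n => [|n ih]; first by rewrite /beta_coef big_ord1 big_ord0 mulr1.
rewrite {1}/beta_coef big_ord_recr/= -/(beta_coef n.+1 p) ih.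
rewrite [in RHS]/beta_coef big_ord_recr/= -/(beta_coef n (p + 1)).
rewrite -[n.+2%:R]natr1; set k := n.+1%:R; set b := beta_coef _ _.
by field; rewrite !gt_eqF// /k ?natr1 ltr0n.
Qed.

Lemma beta_primitive_end (a : R) (n : nat) (p : R) : 0 < a -> 0 < p ->
  beta_primitive a n p a = a `^ p / beta_coef n p.
Proof.
move=> a0; elim: n p => [|n ih] p p0 /=.
  by rewrite /beta_coef big_ord0 divr1.
rewrite divff ?gt_eqF// subrr expr0n/= mulr0 add0r ih ?addr_gt0//.
have -> : a `^ (p + 1) = a `^ p * a.
  have H : (p + 1 == 0) ==> (a != 0) by rewrite (gt_eqF a0) implybT.
  by rewrite (powRD H) powRr1// ltW.
rewrite beta_coefS.
have := beta_coef_gt0 n (addr_gt0 p0 ltr01); set b := beta_coef _ _ => b0.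
by field; apply/and4P; split; apply: lt0r_neq0; rewrite ?ltr_wpDr ?addr_gt0.
Qed.

Lemma continuous_onem_expr (a : R) (n : nat) :
  continuous (fun t : R => (1 - t / a) ^+ n).
Proof.
move=> x.
have c1 : {for x, continuous (fun t : R => 1 - t / a)}.
  apply: continuousB; first exact: cvg_cst.
  by apply: continuousM; [exact: cvg_id|exact: cvg_cst].
exact: (continuous_comp c1 (@exprn_continuous R n _)).
Qed.

(** Every term of the primitive carries a positive power of t, so it vanishes at 0 and only the
    endpoint [a] contributes. *)
Lemma integral_beta (a : R) (n : nat) (p : R) : 0 < a -> 0 < p ->
  (\int[mu]_(t in `]0%R, a]) (p * t `^ (p - 1) * (1 - t / a) ^+ n)%:E
   = (a `^ p / beta_coef n p)%:E)%E.
Proof.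
move=> a0 p0.
have B0 m q : 0 < q -> beta_primitive a m q 0 = 0.
  elim: m q => [|m ih] q q0 /=; first by rewrite powR0// gt_eqF.
  by rewrite powR0 ?gt_eqF// mul0r ih ?addr_gt0// mulr0 addr0.
have <- : beta_primitive a n p a - beta_primitive a n p 0
    = a `^ p / beta_coef n p by rewrite B0// subr0 beta_primitive_end.
apply: ge0_FTC_oc => //.
- move=> x x0; apply: continuousM.
    by apply: continuousM; [exact: cvg_cst|exact: powR_continuous_pos].
  exact: continuous_onem_expr.
- by move=> x x0; exact: is_derive_beta_primitive.
- move=> x /andP[x0 xa]; rewrite mulr_ge0//.
    by rewrite mulr_ge0 ?powR_ge0// ltW.
  by rewrite exprn_ge0// subr_ge0 ler_pdivrMr// mul1r.
rewrite B0//; elim: n p p0 => [|n ih] p p0 /=.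
  by have H := powR_cvg0 p0; exact H.
rewrite -[X in _ --> X]addr0.
apply: cvgD.
  rewrite -[X in _ --> X](mul0r ((1 - 0 / a) ^+ n.+1)); apply: cvgM.
    by have H := powR_cvg0 p0; exact H.
  by apply: cvg_at_right_filter; exact: continuous_onem_expr.
rewrite -[X in _ --> X](mulr0 (n.+1%:R / ((p + 1) * a))).
apply: cvgM; first exact: cvg_cst.
by apply: ih; rewrite addr_gt0.
Qed.

End Integrals.

(** * The Gamma function *)

Section GammaFunction.
Variable R : realType.
Local Notation mu := (@lebesgue_measure R).

Definition gamma_fun (s t : R) : R := t `^ (s - 1) * expR (- t).

Lemma gamma_fun_ge0 s t : 0 <= gamma_fun s t.
Proof. by rewrite mulr_ge0 ?powR_ge0 ?expR_ge0. Qed.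

Lemma gamma_fun_continuous s (t : R) : 0 < t -> {for t, continuous (gamma_fun s)}.
Proof.
move=> t0; apply: continuousM; first exact: powR_continuous_pos.
have c1 : {for t, continuous (fun u : R => - u)} by apply: continuousN; exact: cvg_id.
exact: (continuous_comp c1 (@continuous_expR R _)).
Qed.

Lemma measurable_gamma_fun s : measurable_fun (`]0, +oo[%classic : set R)
  (EFin \o gamma_fun s).
Proof.
apply/measurable_EFinP; apply: continuous_pos_measurable.
exact: gamma_fun_continuous.
Qed.

Lemma integral_gamma_fun_cvg s :
  (\int[mu]_(t in `]0%R, n%:R]) (gamma_fun s t)%:E)%E @[n --> \oo] -->
  (\int[mu]_(t in `]0%R, +oo[) (gamma_fun s t)%:E)%E.
Proof.
rewrite itv_bndy_bigcup_BRight.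
under eq_cvg do rewrite -[_%:R]add0r.
apply: ge0_nondecreasing_set_cvg_integral.
- move=> m n mn; rewrite subsetEset; apply: subset_itvl.
  by rewrite bnd_simp !add0r ler_nat.
- by move=> n; exact: measurable_itv.
- move=> n; apply: measurable_funS (measurable_gamma_fun s) => //.
  by move=> x /=; rewrite !in_itv/= andbT => /andP[].
- by move=> n x _; rewrite lee_fin gamma_fun_ge0.
Qed.

Lemma measurable_fun_oc (f : R -> R) (b : R) :
  (forall x : R, 0 < x -> {for x, continuous f}) ->
  measurable_fun (`]0, b]%classic : set R) (EFin \o f).
Proof.
move=> cf; apply/measurable_EFinP.
apply: measurable_funS (continuous_pos_measurable cf) => //.
by move=> x /=; rewrite !in_itv/= andbT => /andP[].
Qed.

(* Integration by parts; adding the constant [b `^ s] makes the integrand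
   [s * t `^ (s - 1) * expR (- t) - t `^ s * expR (- t)] nonnegative on
   [`]0, b]]. *)
Lemma integral_gamma_fun_trunc (s b : R) : 0 < s -> 0 < b ->
  (\int[mu]_(t in `]0%R, b]) (gamma_fun (s + 1) t)%:E
     + (b `^ s * expR (- b))%:E
   = s%:E * \int[mu]_(t in `]0%R, b]) (gamma_fun s t)%:E)%E.
Proof.
move=> s0 b0.
pose h t := s * gamma_fun s t - gamma_fun (s + 1) t + b `^ s.
pose H t : R := t `^ s * expR (- t) + b `^ s * t.
have ch (x : R) : 0 < x -> {for x, continuous h}.
  move=> x0; apply: continuousD; last exact: cvg_cst.
  apply: continuousB; last exact: gamma_fun_continuous.
  by apply: continuousM; [exact: cvg_cst|exact: gamma_fun_continuous].
have h0 (x : R) : 0 < x <= b -> 0 <= h x.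
  move=> /andP[x0 xb]; rewrite /h -addrA addr_ge0//.
    by rewrite mulr_ge0 ?gamma_fun_ge0// ltW.
  rewrite addrC subr_ge0 /gamma_fun addrK.
  apply: (@le_trans _ _ (x `^ s)).
    by rewrite ler_piMr ?powR_ge0// expR_le1 oppr_le0 ltW.
  by apply: ge0_ler_powR => //; rewrite ?nnegrE ltW.
have dH (x : R) : 0 < x -> is_derive x 1 H (h x).
  move=> x0.
  have d1 : is_derive x 1 (fun t : R => t `^ s) (s * x `^ (s - 1)).
    exact: is_derive1_powR.
  have d2 : is_derive x 1 (fun t : R => expR (- t)) (- expR (- x)).
    by apply: is_derive_eq; rewrite mulrN1.
  have d3 : is_derive x 1 (fun t : R => b `^ s * t) (b `^ s).
    by apply: is_derive_eq; rewrite /GRing.scale/= mulr1.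
  have d4 := is_deriveD (is_deriveM d1 d2) d3.
  apply: (is_derive_eq d4).
  by rewrite /h /gamma_fun addrK /GRing.scale/=; ring.
have H0 : H x @[x --> 0^'+] --> H 0.
  apply: cvgD.
    apply: cvgM.
      by rewrite powR0 ?gt_eqF//; have P := powR_cvg0 s0; exact: P.
    apply: cvg_at_right_filter.
    have c1 : {for 0, continuous (fun u : R => - u)}.
      by apply: continuousN; exact: cvg_id.
    exact: (continuous_comp c1 (@continuous_expR R _)).
  by apply: cvgM; [exact: cvg_cst|apply: cvg_at_right_filter; exact: cvg_id].
have I1 := ge0_FTC_oc b0 ch dH h0 H0.
have mg s' : measurable_fun (`]0, b]%classic : set R) (EFin \o gamma_fun s').
  by apply: measurable_fun_oc; exact: gamma_fun_continuous.
have mI : measurable (`]0, b]%classic : set R) by exact: measurable_itv.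
have I2 : (\int[mu]_(t in `]0%R, b]) (b `^ s)%:E = (b `^ s * b)%:E)%E.
  rewrite integral_cst//.
  have /= -> := lebesgue_measure_itv `]0, b].
  by rewrite lte_fin b0 -EFinB subr0 -EFinM.
have E : (\int[mu]_(t in `]0%R, b]) (h t)%:E
    + \int[mu]_(t in `]0%R, b]) (gamma_fun (s + 1) t)%:E
  = s%:E * \int[mu]_(t in `]0%R, b]) (gamma_fun s t)%:E
    + \int[mu]_(t in `]0%R, b]) (b `^ s)%:E)%E.
  have n1 (x : R) : `]0, b]%classic x -> (0 <= (h x)%:E)%E.
    by move=> /= xb; rewrite lee_fin h0//; move: xb; rewrite in_itv.
  have n2 s' (x : R) : `]0, b]%classic x -> (0 <= (gamma_fun s' x)%:E)%E.
    by move=> _; rewrite lee_fin gamma_fun_ge0.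
  have n3 (x : R) : `]0, b]%classic x -> (0 <= s%:E * (gamma_fun s x)%:E)%E.
    by move=> _; rewrite -EFinM lee_fin mulr_ge0 ?gamma_fun_ge0// ltW.
  have n4 (x : R) : `]0, b]%classic x -> (0 <= (b `^ s)%:E)%E.
    by move=> _; rewrite lee_fin powR_ge0.
  have m1 := measurable_fun_oc (b := b) ch.
  have m3 : measurable_fun (`]0, b]%classic : set R)
      (fun x => s%:E * (gamma_fun s x)%:E)%E.
    apply/measurable_EFinP; apply: measurable_funM => //.
    by apply/measurable_EFinP; exact: mg.
  rewrite -(ge0_integralZl mu mI (mg s))//; last 2 first.
  - exact: n2.
  - by rewrite lee_fin ltW.
  rewrite -(ge0_integralD mu mI n1 m1 (n2 _) (mg _)).
  rewrite -(ge0_integralD mu mI n3 m3 n4); last exact: measurable_cst.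
  by apply: eq_integral => x _; rewrite -EFinM -!EFinD; congr EFin; rewrite /h; ring.
move: E; rewrite I1 I2 => E.
rewrite -(@addeK _ (b `^ s * b)%:E (s%:E * _)%E)// -E /H.
rewrite powR0 ?gt_eqF// mul0r mulr0 addr0 subr0 EFinD.
rewrite [X in _ = (X - _)%E](_ : _ =
    (\int[mu]_(t in `]0%R, b]) (gamma_fun (s + 1) t)%:E
     + (b `^ s * expR (- b))%:E + (b `^ s * b)%:E)%E) ?addeK//.
by rewrite addeC addeA.
Qed.

(** Apply x <= 1 + x <= e^x at x = t / (2s) and raise to the power [s]. The exponent t / 2 leaves a
    factor e^(-t/2) to spare against e^(-t). *)
Lemma powR_le_expR_half (s t : R) : 0 < s -> 0 < t ->
  t `^ s <= (2 * s) `^ s * expR (t / 2).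
Proof.
move=> s0 t0.
have s20 : 0 < 2 * s by rewrite mulr_gt0.
have u0 : 0 <= t / (2 * s) by rewrite divr_ge0// ltW.
have -> : t `^ s = (2 * s) `^ s * (t / (2 * s)) `^ s.
  by rewrite -powRM ?(ltW s20)// mulrC divfK// lt0r_neq0.
apply: ler_wpM2l; first exact: powR_ge0.
rewrite (_ : t / 2 = t / (2 * s) * s); last by field; exact: lt0r_neq0.
rewrite expRM; apply: ge0_ler_powR; rewrite ?nnegrE ?expR_ge0//; first exact: ltW.
by apply: le_trans (expR_ge1Dx _); rewrite lerDr.
Qed.

Lemma gamma_boundary_cvg0 (s : R) : 0 < s ->
  (n%:R `^ s * expR (- n%:R))%:E @[n --> \oo] --> (0 : \bar R).
Proof.
move=> s0; apply: cvg_EFin; first exact: nearW.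
apply: (@squeeze_cvgr _ _ _ _ (fun=> 0)
    (fun n => (2 * s) `^ s * expR (- 2^-1) ^+ n)).
- near=> n; apply/andP; split; first by rewrite mulr_ge0 ?powR_ge0 ?expR_ge0.
  have n0 : 0 < n%:R :> R by rewrite ltr0n; near: n; exact: nbhs_infty_gt.
  rewrite -expRM_natl mulrN.
  apply: (le_trans (ler_wpM2r (expR_ge0 _) (powR_le_expR_half s0 n0))).
  rewrite -mulrA -expRD; apply: ler_wpM2l; first exact: powR_ge0.
  by rewrite ler_expR; lra.
- exact: cvg_cst.
- rewrite -[X in _ --> X](mulr0 ((2 * s) `^ s)).
  apply: cvgM; first exact: cvg_cst.
  apply: cvg_expr; rewrite ger0_norm ?expR_ge0// expR_lt1.
Unshelve. all: by end_near. Qed.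

(** Kept in the extended reals, so that the functional equation follows by a limit before finiteness
    is known. *)
Definition eGamma (s : R) := (\int[mu]_(t in `]0%R, +oo[) (gamma_fun s t)%:E)%E.

Lemma GammaE s : Gamma s = fine (eGamma s). Proof. by []. Qed.

Lemma eGammaS (s : R) : 0 < s -> eGamma (s + 1) = (s%:E * eGamma s)%E.
Proof.
move=> s0.
have C1 := cvgeZl (isT : s%:E \is a fin_num) (integral_gamma_fun_cvg (s := s)).
have C2 : (\int[mu]_(t in `]0%R, n%:R]) (gamma_fun (s + 1) t)%:E
     + (n%:R `^ s * expR (- n%:R))%:E)%E @[n --> \oo] --> (eGamma (s + 1) + 0)%E.
  have H := integral_gamma_fun_cvg (s := s + 1).
  have H' := gamma_boundary_cvg0 s0.
  by apply: (cvgeD _ H H'); exact: fin_num_adde_defl.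
rewrite adde0 in C2.
suff C3 : (\int[mu]_(t in `]0%R, n%:R]) (gamma_fun (s + 1) t)%:E
     + (n%:R `^ s * expR (- n%:R))%:E)%E @[n --> \oo] --> (s%:E * eGamma s)%E.
  exact: cvg_unique C2 C3.
apply: cvg_trans C1; apply: near_eq_cvg; near=> n.
rewrite integral_gamma_fun_trunc// ltr0n.
by near: n; exact: nbhs_infty_gt.
Unshelve. all: by end_near. Qed.

Lemma integral_expRN_oc (c b : R) : 0 < c -> 0 < b ->
  (\int[mu]_(t in `]0%R, b]) (expR (- (c * t)))%:E
   = ((1 - expR (- (c * b))) / c)%:E)%E.
Proof.
move=> c0 b0.
pose F (t : R) := - expR (- (c * t)) / c.
have dE (x : R) : is_derive x 1 (fun t => expR (- (c * t))) (- c * expR (- (c * x))).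
  by apply: is_derive_eq; rewrite /GRing.scale/=; ring.
have cE (x : R) : {for x, continuous (fun t => expR (- (c * t)))}.
  apply: differentiable_continuous; apply/derivable1_diffP.
  by have := dE x => ?; exact: ex_derive.
have dF (x : R) : is_derive x 1 F (expR (- (c * x))).
  have d1 := is_deriveZ (- c^-1) (dE x).
  rewrite (_ : F = (- c^-1) \*: (fun t => expR (- (c * t)))); last first.
    apply/funext => t; change (- expR (- (c * t)) / c = - c^-1 * expR (- (c * t))).
    by rewrite mulNr mulrC mulNr.
  by apply: (is_derive_eq d1); rewrite /GRing.scale/=; field; exact: lt0r_neq0.
rewrite (_ : (1 - _) / c = F b - F 0).
  have Fc : F x @[x --> 0^'+] --> F 0.
    apply: cvg_at_right_filter; apply: differentiable_continuous.
    by apply/derivable1_diffP; have := dF 0 => ?; exact: ex_derive.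
  exact: (ge0_FTC_oc b0 (fun x _ => cE x) (fun x _ => dF x) (fun x _ => expR_ge0 _) Fc).
by rewrite /F mulr0 oppr0 expR0; field; exact: lt0r_neq0.
Qed.

Lemma eGamma1 : eGamma 1 = 1%E.
Proof.
have C2 : (1 - expR (- n%:R))%:E @[n --> \oo] --> (1%E : \bar R).
  apply: cvg_EFin; first exact: nearW.
  rewrite -[X in _ --> X]subr0; apply: cvgB; [exact: cvg_cst|exact: cvgn_expR].
have C1 := integral_gamma_fun_cvg (s := 1).
suff C3 : (\int[mu]_(t in `]0%R, n%:R]) (gamma_fun 1 t)%:E)%E @[n --> \oo]
    --> (1%E : \bar R) by exact: cvg_unique C1 C3.
apply: cvg_trans C2; apply: near_eq_cvg; near=> n.
have n0 : 0 < n%:R :> R by rewrite ltr0n; near: n; exact: nbhs_infty_gt.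
have := integral_expRN_oc ltr01 n0; rewrite mul1r divr1 => <-.
by apply: eq_integral => t _; rewrite /gamma_fun subrr powRr0 !mul1r.
Unshelve. all: by end_near. Qed.

(** The integrand is dominated by (2s)^s e^(-t/2), whose truncated integrals are at most 2
    (2s)^s. *)
Lemma eGammaS_lty (s : R) : 0 < s -> (eGamma (s + 1) < +oo)%E.
Proof.
move=> s0; apply: (@le_lt_trans _ _ (2 * (2 * s) `^ s)%:E); last exact: ltry.
apply: (cvge_to_le (integral_gamma_fun_cvg (s := s + 1))).
near=> n.
have n0 : 0 < n%:R :> R by rewrite ltr0n; near: n; exact: nbhs_infty_gt.
have h0 : 0 < 2^-1 :> R by rewrite invr_gt0.
have m1 : measurable_fun (`]0, n%:R]%classic : set R)
    (EFin \o (fun t => expR (- (2^-1 * t)))).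
  apply/measurable_EFinP; apply: measurable_funTS; apply: measurableT_comp => //.
  by apply: measurableT_comp => //; exact: measurable_funM.
have mE : measurable_fun (`]0, n%:R]%classic : set R)
    (fun t => ((2 * s) `^ s)%:E * (expR (- (2^-1 * t)))%:E)%E.
  by apply: emeasurable_funM => //; exact: measurable_cst.
apply: (@le_trans _ _ (\int[mu]_(t in `]0%R, n%:R])
    (((2 * s) `^ s)%:E * (expR (- (2^-1 * t)))%:E))%E).
  apply: ge0_le_integral => //.
  - by move=> t _; rewrite lee_fin gamma_fun_ge0.
  - by apply: measurable_fun_oc; exact: gamma_fun_continuous.
  - move=> t /=; rewrite in_itv/= => /andP[t0 _].
    rewrite -EFinM lee_fin /gamma_fun addrK.
    apply: (le_trans (ler_wpM2r (expR_ge0 _) (powR_le_expR_half s0 t0))).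
    rewrite -mulrA -expRD; apply: ler_wpM2l; first exact: powR_ge0.
    by rewrite ler_expR; lra.
rewrite ge0_integralZl//; last first.
- by rewrite lee_fin powR_ge0.
rewrite integral_expRN_oc// -EFinM lee_fin invrK [leRHS]mulrC.
apply: ler_wpM2l; first exact: powR_ge0.
by rewrite ler_piMl// gerBl expR_ge0.
Unshelve. all: by end_near. Qed.

(** If the integral over ]0, 1] vanished, the integration by parts with [b = 1] would equate 0 with
    a sum that is at least e^(-1). *)
Lemma eGamma_gt0 (s : R) : 0 < s -> (0 < eGamma s)%E.
Proof.
move=> s0; have I := integral_gamma_fun_trunc s0 ltr01.
have P : (0 < \int[mu]_(t in `]0%R, 1%R]) (gamma_fun s t)%:E)%E.
  rewrite lt_neqAle integral_ge0 ?andbT; last first.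
    by move=> t _; rewrite lee_fin gamma_fun_ge0.
  apply/eqP => E; move: I; rewrite -E mule0; apply/eqP.
  rewrite gt_eqF// powR1 mul1r; apply: (@lt_le_trans _ _ (expR (- 1))%:E).
    by rewrite lte_fin expR_gt0.
  rewrite leeDr//; apply: integral_ge0 => t _.
  by rewrite lee_fin gamma_fun_ge0.
apply: (lt_le_trans P); apply: ge0_subset_integral => //.
- exact: measurable_gamma_fun.
- by move=> t _; rewrite lee_fin gamma_fun_ge0.
- by move=> t /=; rewrite !in_itv/= andbT => /andP[].
Qed.

Lemma GammaS (s : R) : 0 < s -> Gamma (s + 1) = s * Gamma s.
Proof.
move=> s0; rewrite !GammaE eGammaS//.
(* In the infinite cases both sides are 0, because [fine] sends infinities to 0. *)
by case: (eGamma s) => [r|//|]//=; rewrite ?gt0_muley ?gt0_muleNy ?lte_fin//= mulr0.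
Qed.

Lemma Gamma1 : Gamma 1 = 1 :> R.
Proof. by rewrite GammaE eGamma1. Qed.

Lemma GammaS_gt0 (s : R) : 0 < s -> 0 < Gamma (s + 1).
Proof.
move=> s0; rewrite GammaE fine_gt0// eGammaS_lty// andbT.
by apply: eGamma_gt0; rewrite addr_gt0.
Qed.

Lemma GammaDn (n : nat) (s : R) : 0 < s ->
  Gamma (n%:R + s) = \prod_(i < n) (s + i%:R) * Gamma s.
Proof.
move=> s0; elim: n => [|n ih]; first by rewrite add0r big_ord0 mul1r.
rewrite -natr1 addrAC GammaS ?ltr_wpDl// ih big_ord_recr/= [_ * (s + _)]mulrC.
by rewrite mulrA [n%:R + s]addrC.
Qed.

(** The functional equation turns the Gamma values into products, and [Gamma (p + 1)], which is
    nonzero, cancels. *)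
Lemma gbinomE (n : nat) (p : R) : 0 < p -> gbinom n p = beta_coef n p.
Proof.
move=> p0; rewrite /gbinom /beta_coef -addrA !GammaDn ?addr_gt0//.
rewrite Gamma1 mulr1 prodf_div -mulf_div divff ?lt0r_neq0 ?GammaS_gt0// mulr1.
congr (_ / _); apply: eq_bigr => i _; rewrite -natr1.
  by rewrite -addrA [1 + _]addrC.
by rewrite addrC.
Qed.

End GammaFunction.

(** * Single crossing *)

Section Berwald.
Variable R : realType.
Local Notation mu := (@lebesgue_measure R).
Local Notation Rpos := (`]0, +oo[%classic : set R).

Lemma measurable_pos_cut (f : R -> R) (c : R) :
  (forall x : R, 0 < x -> {for x, continuous f}) ->
  measurable_fun Rpos (EFin \o (fun t => f t * (t <= c)%R%:R)).
Proof.
move=> cf; apply/measurable_EFinP; apply: measurable_funM.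
  exact: continuous_pos_measurable.
rewrite (_ : (fun t => (t <= c)%R%:R) = \1_(`]-oo, c]%classic)).
  by apply: measurable_funTS; apply: measurable_indic; exact: measurable_itv.
apply/funext => t; rewrite indicE; congr (nat_of_bool _)%:R.
by apply/idP/idP; rewrite inE /= in_itv.
Qed.

Lemma integral_pos_cut (f : R -> R) (c : R) :
  (\int[mu]_(t in `]0%R, +oo[) (f t * (t <= c)%R%:R)%:E
   = \int[mu]_(t in `]0%R, c]) (f t)%:E)%E.
Proof.
have -> : `]0, c]%classic = `]0, +oo[%classic `&` (`]-oo, c]%classic : set R).
  apply/seteqP; split=> x /=; rewrite !in_itv/= ?andbT.
    by move=> /andP[].
  by move=> [-> ->].
rewrite integral_mkcondr; apply: eq_integral => t _.
rewrite patchE; case: ifPn => [|/negP tc].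
  by rewrite inE/= in_itv/= => ->; rewrite mulr1.
case: (boolP (t <= c)%R) => H; last by rewrite mulr0.
by exfalso; apply: tc; rewrite inE/= in_itv.
Qed.

(** The derivative of t^p, which is the weight of the layer-cake formula for p-th powers. *)
Definition moment (p t : R) : R := p * t `^ (p - 1).

Lemma moment_ge0 p t : 0 <= p -> 0 <= moment p t.
Proof. by move=> p0; rewrite mulr_ge0 ?powR_ge0. Qed.

Lemma moment_continuous p (t : R) : 0 < t -> {for t, continuous (moment p)}.
Proof.
move=> t0; apply: continuousM; first exact: cvg_cst.
exact: powR_continuous_pos.
Qed.

(** The fraction of an n-dimensional base over which a cone of height [a] reaches level [t]. The
    indicator takes the positive part beyond [a], where the bare power need not vanish. *)
Definition cone_profile (n : nat) (a t : R) : R :=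
  (1 - t / a) ^+ n * (t <= a)%R%:R.

Lemma cone_profile_ge0 n a t : 0 < a -> 0 <= cone_profile n a t.
Proof.
move=> a0; rewrite /cone_profile; case: (leP t a) => ta; last by rewrite mulr0.
by rewrite mulr1 exprn_ge0// subr_ge0 ler_pdivrMr// mul1r.
Qed.

Definition count_ge (I : Type) (v : I -> R) (s : seq I) (t : R) : R :=
  (count (fun i => t <= v i) s)%:R.

Lemma count_geE (I : Type) (v : I -> R) (s : seq I) (t : R) :
  count_ge v s t = \sum_(i <- s) (t <= v i)%R%:R.
Proof. exact: count_natr. Qed.

Lemma moment_count_geE (I : Type) (v : I -> R) (s : seq I) (p t : R) :
  (moment p t * count_ge v s t)%:E
  = (\sum_(i <- s) (moment p t * (t <= v i)%R%:R)%:E)%E.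
Proof. by rewrite count_geE mulr_sumr sumEFin. Qed.

Lemma measurable_moment_count (I : Type) (v : I -> R) (s : seq I) (p : R) :
  measurable_fun Rpos (fun t => (moment p t * count_ge v s t)%:E).
Proof.
rewrite (_ : (fun t => _) = (fun t =>
    (\sum_(i <- s) (moment p t * (t <= v i)%R%:R)%:E)%E)); last first.
  by apply/funext => t; exact: moment_count_geE.
apply: emeasurable_sum => i; apply: measurable_pos_cut.
exact: moment_continuous.
Qed.

Lemma integral_moment_count (I : Type) (v : I -> R) (s : seq I) (p : R) :
  0 < p -> (forall i, 0 <= v i) ->
  (\int[mu]_(t in `]0%R, +oo[) (moment p t * count_ge v s t)%:E
   = (\sum_(i <- s) v i `^ p)%:E)%E.
Proof.
move=> p0 v0; under eq_integral do rewrite moment_count_geE.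
rewrite ge0_integral_sum//.
- rewrite -sumEFin; apply: eq_bigr => i _.
  by rewrite integral_pos_cut integral_powR_oc.
- by move=> i; apply: measurable_pos_cut; exact: moment_continuous.
- by move=> i t _; rewrite lee_fin mulr_ge0// moment_ge0// ltW.
Qed.

Lemma moment_cone_continuous n (a p t : R) : 0 < t ->
  {for t, continuous (fun t => moment p t * (1 - t / a) ^+ n)}.
Proof.
move=> t0; apply: continuousM; first exact: moment_continuous.
exact: continuous_onem_expr.
Qed.

Lemma measurable_moment_cone n (a p : R) :
  measurable_fun Rpos (fun t => (moment p t * cone_profile n a t)%:E).
Proof.
rewrite (_ : (fun t => _) = EFin \o (fun t =>
    (moment p t * (1 - t / a) ^+ n) * (t <= a)%R%:R)); last first.
  by apply/funext => t; rewrite /= mulrA.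
by apply: measurable_pos_cut; exact: moment_cone_continuous.
Qed.

Lemma integral_moment_cone n (a p : R) : 0 < a -> 0 < p ->
  (\int[mu]_(t in `]0%R, +oo[) (moment p t * cone_profile n a t)%:E
   = (a `^ p / beta_coef n p)%:E)%E.
Proof.
move=> a0 p0; under eq_integral do rewrite /cone_profile mulrA.
by rewrite integral_pos_cut integral_beta.
Qed.

Lemma ge0_integral_comb (f g : R -> R) (c If Ig : R) : 0 <= c ->
  measurable_fun Rpos (EFin \o f) -> measurable_fun Rpos (EFin \o g) ->
  (forall t, 0 <= f t) -> (forall t, 0 <= g t) ->
  (\int[mu]_(t in `]0%R, +oo[) (f t)%:E = If%:E)%E ->
  (\int[mu]_(t in `]0%R, +oo[) (g t)%:E = Ig%:E)%E ->
  measurable_fun Rpos (EFin \o (fun t => f t + c * g t)) /\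
  (\int[mu]_(t in `]0%R, +oo[) (f t + c * g t)%:E = (If + c * Ig)%:E)%E.
Proof.
move=> c0 mf mg f0 g0 Hf Hg.
have mcg : measurable_fun Rpos (fun t => c%:E * (g t)%:E)%E.
  by apply: emeasurable_funM => //; exact: measurable_cst.
split.
  rewrite (_ : _ \o _ = (fun t => (f t)%:E + c%:E * (g t)%:E)%E).
    exact: emeasurable_funD.
  by apply/funext => t /=; rewrite -EFinM -EFinD.
under eq_integral do rewrite EFinD EFinM.
rewrite ge0_integralD//.
- by rewrite ge0_integralZl// ?Hf ?Hg ?EFinD ?EFinM// => t _; rewrite lee_fin.
- by move=> t _; rewrite lee_fin.
- by move=> t _; rewrite -EFinM lee_fin mulr_ge0.
Qed.

(* Single crossing: let [ts] be the last point where the counting function of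
   [u] lies above the cone profile.  With [c = p / q * ts `^ (p - q)] the sign
   of [moment p - c * moment q] changes from [+] to [-] at [ts], where
   [count_ge w] (above the profile before [ts]) is replaced by the smaller
   [count_ge u]. *)
Lemma cone_comparison (I J : Type) (u : I -> R) (w : J -> R) (s1 : seq I)
    (s2 : seq J) (n : nat) (p q a N : R) :
  0 < p -> p <= q -> 0 < a -> 0 < N ->
  (forall i, 0 <= u i) -> (forall j, 0 <= w j) ->
  (forall t : R, 0 < t -> count_ge u s1 t <= count_ge w s2 t) ->
  (forall t t' : R, 0 < t < t' -> 0 < count_ge u s1 t' ->
     N * cone_profile n a t' <= count_ge u s1 t' ->
     N * cone_profile n a t <= count_ge w s2 t) ->
  N * (a `^ q / beta_coef n q) < \sum_(i <- s1) u i `^ q ->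
  N * (a `^ p / beta_coef n p) <= \sum_(j <- s2) w j `^ p.
Proof.
move=> p0 pq a0 N0 u0 w0 H1 H2 Hq.
have q0 : 0 < q := lt_le_trans p0 pq.
set F := count_ge u s1 in H1 H2 *; set G := count_ge w s2 in H1 H2 *.
pose X t := N * cone_profile n a t.
have X0 t : 0 <= X t by rewrite mulr_ge0 ?cone_profile_ge0// ltW.
have F0 t : 0 <= F t by rewrite /F /count_ge.
have G0 t : 0 <= G t by rewrite /G /count_ge.
(* The condition [0 < F t] bounds [T]: for large t both [X] and [F] vanish, and [X t <= F t] alone
   would hold there. *)
pose T := [set t : R | [/\ 0 < t, 0 < F t & X t <= F t]].
have notT (t : R) : 0 < t -> ~ T t -> F t <= X t.
  move=> t0 nT; rewrite leNgt; apply/negP => XF; apply: nT; split => //.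
    exact: le_lt_trans XF.
  exact: ltW.
have mX r : measurable_fun Rpos (EFin \o (fun t => moment r t * X t)).
  rewrite (_ : EFin \o _ =
      (fun t => N%:E * (moment r t * cone_profile n a t)%:E)%E).
    apply: emeasurable_funM; first exact: measurable_cst.
    exact: measurable_moment_cone.
  by apply/funext => t /=; rewrite -EFinM /X mulrCA.
have iX (r : R) : 0 < r -> (\int[mu]_(t in `]0%R, +oo[) (moment r t * X t)%:E
    = (N * (a `^ r / beta_coef n r))%:E)%E.
  move=> r0; under eq_integral do rewrite /X mulrCA EFinM.
  rewrite ge0_integralZl//.
  - by rewrite integral_moment_cone.
  - exact: measurable_moment_cone.
  - by move=> t _; rewrite lee_fin mulr_ge0 ?cone_profile_ge0// moment_ge0// ltW.
  - by rewrite lee_fin ltW.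
have mF r : measurable_fun Rpos (EFin \o (fun t => moment r t * F t)).
  exact: measurable_moment_count.
have mG r : measurable_fun Rpos (EFin \o (fun t => moment r t * G t)).
  exact: measurable_moment_count.
have [t1 Tt1] : T !=set0.
  apply/set0P/negP => /eqP T0; move: Hq; apply/negP; rewrite -leNgt -lee_fin.
  rewrite -iX// -integral_moment_count//; apply: ge0_le_integral => //.
  - by move=> t _; rewrite lee_fin mulr_ge0// moment_ge0// ltW.
  - exact: mF.
  - exact: mX.
  - move=> t /=; rewrite in_itv/= andbT => t0; rewrite lee_fin.
    apply: ler_wpM2l; first by rewrite moment_ge0// ltW.
    by apply: notT => //; rewrite T0.
have bT : ubound T (\sum_(i <- s1) u i).
  move=> t [t0 Ft _]; move: Ft; rewrite /F /count_ge ltr0n -has_count.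
  elim: s1 {F H1 H2 Hq F0 T notT mF t1 Tt1} => [//|i s ih] /= /orP[ti|/ih ti].
    by rewrite big_cons (le_trans ti)// lerDl sumr_ge0.
  by rewrite big_cons (le_trans ti)// lerDr.
have hT : has_sup T by split; [exists t1|exists (\sum_(i <- s1) u i)].
pose ts := sup T.
have tsT (t : R) : T t -> t <= ts by move=> Tt; apply: ub_le_sup => //; case: hT.
have ts0 : 0 < ts by apply: lt_le_trans (tsT _ Tt1); case: Tt1.
pose c := p / q * ts `^ (p - q).
have c0 : 0 < c by rewrite mulr_gt0 ?divr_gt0 ?powR_gt0.
(* Terms are moved across so that both integrands are nonnegative. With [moment p t] factored out,
   the claim is X + d F <= G + d X, where d <= 1 before [ts] and d >= 1 from [ts] on. *)
have key (t : R) : 0 < t -> moment p t * X t + c * (moment q t * F t)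
    <= moment p t * G t + c * (moment q t * X t).
  move=> t0; pose d := (t / ts) `^ (q - p).
  have cE : c * moment q t = moment p t * d.
    have E1 : t `^ (q - 1) = t `^ (p - 1) * t `^ (q - p).
      rewrite -powRD; last by rewrite (gt_eqF t0) implybT.
      by congr powR; lra.
    have E2 : d = t `^ (q - p) * ts `^ (p - q).
      rewrite /d powRM ?invr_ge0; try exact: ltW.
      congr (_ * _); rewrite -powR_inv1; last exact: ltW.
      by rewrite -powRrM; congr powR; lra.
    rewrite E2 /moment E1 /c; field; exact: lt0r_neq0.
  have d0 : 0 <= d by exact: powR_ge0.
  have M0 : 0 <= moment p t by rewrite moment_ge0// ltW.
  have cM v : c * (moment q t * v) = moment p t * (d * v).
    by rewrite mulrA cE mulrA.
  rewrite !cM -!mulrDr; apply: ler_wpM2l => //.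
  have FG := H1 t t0.
  have p1 : 1 `^ (q - p) = 1 :> R by rewrite powR1.
  case: (ltP t ts) => tts.
    have d1 : d <= 1.
      rewrite /d -[X in _ <= X]p1; apply: ge0_ler_powR.
      - by rewrite subr_ge0.
      - by rewrite nnegrE divr_ge0// ltW.
      - by rewrite nnegrE.
      - by rewrite ler_pdivrMr// mul1r ltW.
    have XG : X t <= G t.
      have e0 : 0 < ts - t by rewrite subr_gt0.
      have [t' [t'0 Ft' Xt']] := sup_adherent e0 hT.
      by rewrite opprB addrC subrK => tt'; apply: (H2 t t') => //; rewrite t0.
    have := ler_wpM2l d0 FG.
    have : 0 <= (1 - d) * (G t - X t) by rewrite mulr_ge0 ?subr_ge0.
    by lra.
  have d1 : 1 <= d.
    rewrite /d -[X in X <= _]p1; apply: ge0_ler_powR.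
    - by rewrite subr_ge0.
    - by rewrite nnegrE.
    - by rewrite nnegrE divr_ge0// ltW.
    - by rewrite ler_pdivlMr// mul1r.
  (* The supremum may belong to [T], and then t = ts and d = 1. Every other t here is outside [T],
     where F <= X. *)
  have [/tsT tts'|/(notT _ t0) FX] := pselect (T t).
    have -> : d = 1 by rewrite /d (@le_anti _ _ t ts) ?tts ?tts'// divff ?powR1 ?lt0r_neq0.
    by lra.
  have : 0 <= (d - 1) * (X t - F t) by rewrite mulr_ge0 ?subr_ge0.
  by lra.
have n0 r (f : R -> R) (r0 : 0 < r) (f0 : forall t, 0 <= f t) t :
    0 <= moment r t * f t by rewrite mulr_ge0// moment_ge0// ltW.
have [mL iL] := ge0_integral_comb (ltW c0) (mX p) (mF q) (n0 _ _ p0 X0)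
  (n0 _ _ q0 F0) (iX p p0) (integral_moment_count s1 q0 u0).
have [mR iR] := ge0_integral_comb (ltW c0) (mG p) (mX q) (n0 _ _ p0 G0)
  (n0 _ _ q0 X0) (integral_moment_count s2 p0 w0) (iX q q0).
have : N * (a `^ p / beta_coef n p) + c * (\sum_(i <- s1) u i `^ q)
    <= \sum_(j <- s2) w j `^ p + c * (N * (a `^ q / beta_coef n q)).
  rewrite -lee_fin -iL -iR; apply: ge0_le_integral => //.
  - by move=> t _; rewrite lee_fin addr_ge0 ?n0// mulr_ge0 ?n0// ltW.
  - move=> t /=; rewrite in_itv/= andbT => t0; rewrite lee_fin; exact: key.
move: Hq; rewrite -(ltr_pM2l c0) => /ltW Hq H.
by rewrite -(lerD2r (c * (N * (a `^ q / beta_coef n q)))) (le_trans _ H)// lerD2l.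
Qed.

(** By contradiction: if the inequality fails, take for [a] the midpoint of the two means. Then a^q
    lies strictly below the quantity on the left, so [cone_comparison] applies, and its conclusion
    contradicts that a^p lies strictly above the one on the right. *)
Lemma discrete_berwald (I J : Type) (u : I -> R) (w : J -> R) (s1 : seq I)
    (s2 : seq J) (n : nat) (p q N : R) :
  0 < p -> p <= q -> 0 < N ->
  (forall i, 0 <= u i) -> (forall j, 0 <= w j) ->
  (forall t : R, 0 < t -> count_ge u s1 t <= count_ge w s2 t) ->
  (forall a t t' : R, 0 < a -> 0 < t < t' -> 0 < count_ge u s1 t' ->
     N * cone_profile n a t' <= count_ge u s1 t' ->
     N * cone_profile n a t <= count_ge w s2 t) ->
  (beta_coef n q / N * \sum_(i <- s1) u i `^ q) `^ q^-1
  <= (beta_coef n p / N * \sum_(j <- s2) w j `^ p) `^ p^-1.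
Proof.
move=> p0 pq N0 u0 w0 H1 H2; have q0 : 0 < q := lt_le_trans p0 pq.
have bp := beta_coef_gt0 n p0; have bq := beta_coef_gt0 n q0.
set A := _ * \sum_(i <- s1) _; set B := _ * \sum_(j <- s2) _.
have A0 : 0 <= A by rewrite mulr_ge0 ?divr_ge0 ?sumr_ge0// ?ltW// => i _; exact: powR_ge0.
have B0 : 0 <= B by rewrite mulr_ge0 ?divr_ge0 ?sumr_ge0// ?ltW// => i _; exact: powR_ge0.
rewrite leNgt; apply/negP => BA.
pose a := (A `^ q^-1 + B `^ p^-1) / 2.
have a1 : B `^ p^-1 < a by rewrite /a; lra.
have a2 : a < A `^ q^-1 by rewrite /a; lra.
have a0 : 0 < a by apply: le_lt_trans a1; exact: powR_ge0.
have aA : a `^ q < A.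
  have := gt0_ltr_powR q0 _ _ a2; rewrite !nnegrE powR_ge0 -powRrM mulVf ?lt0r_neq0//.
  by rewrite powRr1//; apply=> //; exact: ltW.
have Ba : B < a `^ p.
  have := gt0_ltr_powR p0 _ _ a1; rewrite !nnegrE powR_ge0 -powRrM mulVf ?lt0r_neq0//.
  by rewrite powRr1//; apply=> //; exact: ltW.
have : N * (a `^ q / beta_coef n q) < \sum_(i <- s1) u i `^ q.
  move: aA; rewrite /A mulrAC ltr_pdivlMr// mulrC => aA.
  by rewrite mulrA ltr_pdivrMr// [ltRHS]mulrC.
move/(cone_comparison p0 pq a0 N0 u0 w0 H1 (fun t t' => @H2 a t t' a0)).
apply/negP; rewrite -ltNge mulrA ltr_pdivlMr// mulrC.
by move: Ba; rewrite /B mulrAC ltr_pdivrMr// [ltRHS]mulrC.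
Qed.

End Berwald.

(** * Lattice points and concave functions on a convex body *)

Section Lattice.
Variables (R : realType) (n : nat).
Implicit Types (K : set 'rV[R]_n) (h : 'rV[R]_n -> R).

Lemma compact_coord_bound K : compact K ->
  exists2 B : R, 0 < B & forall x, K x -> forall i, `|x 0 i| <= B.
Proof.
move=> /compact_bounded[M [_ HM]].
exists (Num.max M 0 + 1); first by rewrite ltr_wpDl// le_max lexx orbT.
move=> x Kx i; have := HM (Num.max M 0 + 1) _ x Kx.
have /[swap]/[apply] : M < Num.max M 0 + 1.
  by rewrite (@le_lt_trans _ _ (Num.max M 0)) ?le_max ?lexx// ltrDl.
apply: le_trans; rewrite [leRHS]/Num.norm /= mx_normrE; apply/bigmax_geP; right => /=.
by exists (0, i).
Qed.

Lemma finite_lattice_bounded (A : set 'rV[R]_n) (B : R) :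
  (forall x, A x -> forall i, `|x 0 i| <= B) ->
  finite_set (A `&` integer_lattice R n).
Proof.
move=> HB; have [m Bm] : exists m : nat, B <= m%:R.
  by exists (Num.bound `|B|); rewrite ltW// (le_lt_trans (ler_norm _))// archi_boundP.
(* Integers in [-m, m] are encoded as k - m with k from 0 to 2m, so that the lattice points are
   covered by the image of a finite function type. *)
pose g (k : {ffun 'I_n -> 'I_(m + m).+1}) : 'rV[R]_n :=
  \row_i ((k i)%:R - m%:R).
apply: (@sub_finite_set _ _ (g @` setT)); last first.
  by apply: finite_image; exact: finite_finset.
move=> x [Ax Zx]; exists [ffun i : 'I_n => inord (absz (Num.floor (x 0 i + m%:R)))] => //.
apply/rowP => i; rewrite mxE ffunE.
have /andP[xl xu] : - m%:R <= x 0 i <= m%:R.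
  by rewrite -ler_norml (le_trans (HB x Ax i)).
have /intrP[z zE] : x 0 i + m%:R \is a Num.int.
  by rewrite rpredD ?natr_int//; exact: (Zx i).
have z0 : 0 <= z by rewrite -(ler_int R) -zE; lra.
have zm : z <= (m + m)%:Z by rewrite -(ler_int R) -zE -pmulrn natrD; lra.
rewrite zE intrKfloor inordK.
  have : `|z|%N%:R = z%:~R :> R by rewrite pmulrn gez0_abs.
  by move=> ->; rewrite -zE addrK.
by rewrite ltnS -lez_nat gez0_abs.
Qed.

Lemma lattice_points (A : set 'rV[R]_n) (B : R) :
  (forall x, A x -> forall i, `|x 0 i| <= B) ->
  exists2 s : seq 'rV[R]_n, uniq s &
    forall x, (x \in s) <-> (A x /\ forall i, x 0 i \is a Num.int).
Proof.
move=> /finite_lattice_bounded/finite_seqP[s sE].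
exists (undup s); first exact: undup_uniq.
move=> x; rewrite mem_undup; split.
  move=> xs; have : [set` s] x by [].
  by rewrite -sE.
move=> xA; have : (A `&` integer_lattice R n) x by [].
by rewrite sE.
Qed.

Lemma lattice_enum1 (x : 'rV[R]_n) : (forall i, x 0 i \is a Num.int) ->
  lattice_enum R n [set x] = 1%E.
Proof.
move=> Zx; rewrite /lattice_enum /mrestr /counting.
have -> : [set x] `&` integer_lattice R n = [set x].
  by apply/seteqP; split=> y [] // ->.
rewrite asboolT; last exact: finite_set1.
by rewrite fset_set1 finmap.cardfs1.
Qed.

(** The complement of the lattice is a null set, and the rest of [A] is a finite disjoint union of
    singletons of mass 1. *)
Lemma integral_lattice_enum (A : set 'rV[R]_n) (s : seq 'rV[R]_n) (f : 'rV[R]_n -> R) :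
  uniq s -> (forall x, (x \in s) <-> (A x /\ forall i, x 0 i \is a Num.int)) ->
  (forall x, 0 <= f x) ->
  (\int[lattice_enum R n]_(x in A) (f x)%:E = (\sum_(x <- s) f x)%:E)%E.
Proof.
move=> us sE f0.
rewrite (@ge0_negligible_integral _ _ _ _ _ (~` integer_lattice R n))//; last 2 first.
  by move=> x _; rewrite lee_fin.
  change (counting (~` integer_lattice R n `&` integer_lattice R n) = 0%E :> \bar R).
  rewrite setICl /counting.
  rewrite asboolT; last exact: finite_set0.
  by rewrite fset_set0.
have -> : A `\` ~` integer_lattice R n = \big[setU/set0]_(x <- s) [set x].
  rewrite setDE setCK; apply/seteqP; split=> [x xA|x].
    rewrite -bigcup_seq; exists x => //=.
    by apply/sE.
  by rewrite -bigcup_seq => -[y /= /sE ys ->].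
rewrite ge0_integral_bigsetU//; last 2 first.
- by move=> x y _ _ [z [-> ->]].
- by move=> x _; rewrite lee_fin.
rewrite -sumEFin big_seq [RHS]big_seq; apply: eq_bigr => x /sE[_ Zx].
rewrite (eq_integral (cst (f x)%:E)); last by move=> y; rewrite inE /= => ->.
by rewrite integral_cst// [X in (_ * X)%E](lattice_enum1 Zx) mule1.
Qed.

Lemma lattice_enumE (A : set 'rV[R]_n) (s : seq 'rV[R]_n) :
  uniq s -> (forall x, (x \in s) <-> (A x /\ forall i, x 0 i \is a Num.int)) ->
  lattice_enum R n A = (size s)%:R%:E.
Proof.
move=> us sE; rewrite -[LHS]mul1e -integral_cst//.
rewrite (integral_lattice_enum (f := fun=> 1) us sE)//.
by rewrite big_const_seq count_predT iter_addr_0.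
Qed.

Lemma convex_combination K (x y : 'rV[R]_n) (l : R) :
  convex_set K -> 0 <= l <= 1 -> K x -> K y -> K ((1 - l) *: x + l *: y).
Proof.
move=> cK /andP[l0 l1] Kx Ky.
have := cK y x (Itv01 l0 l1); rewrite !inE => /(_ Ky Kx).
by rewrite /conv/= addrC.
Qed.

Lemma concave_combination K h (x y : 'rV[R]_n) (l : R) :
  concave_function K h -> 0 <= l <= 1 -> K x -> K y ->
  (1 - l) * h x + l * h y <= h ((1 - l) *: x + l *: y).
Proof.
move=> ch /andP[l0 l1] Kx Ky.
have := ch (Itv01 l0 l1) y x; rewrite !inE => /(_ Ky Kx).
by rewrite convRE /conv/= addrC [X in _ <= h X]addrC.
Qed.

(* With [c] interior to [K], every [x] in [K] has a reflection
   [y = c - e *: (x - c)] in [K], and concavity along [x, c, y] bounds [h x] by a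
   multiple of [h c]. *)
Lemma concave_bounded K h : convex_body K -> (forall x, K x -> 0 <= h x) ->
  concave_function K h -> exists M : R, forall x, K x -> h x <= M.
Proof.
move=> [cK kK [c Kc]] h0 ch.
have [B B0 HB] := compact_coord_bound kK.
have Kc' : K c by exact: nbhs_singleton.
move: Kc => /nbhs_ballP[e /= e0 He].
(* Coordinates of [x - c] are at most 2B in absolute value, so the reflected point stays within e/2
   of [c], inside the ball. *)
pose d := e / (4 * B).
have d0 : 0 < d by rewrite divr_gt0// mulr_gt0.
exists ((1 + d) / d * h c) => x Kx.
pose y := c - d *: (x - c).
have Ky : K y.
  apply: He; split => // i j; rewrite /y !mxE ord1 /ball/= opprD opprK addNKr.
  rewrite normrM gtr0_norm//.
  have : `|x 0 j - c 0 j| <= B + B.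
    by apply: le_trans (ler_normB _ _) _; rewrite lerD ?HB.
  move=> /(ler_wpM2l (ltW d0)) /le_lt_trans; apply.
  rewrite (_ : d * (B + B) = e / 2); first by rewrite ltr_pdivrMr// ltr_pMr// ltr1n.
  by rewrite /d; field; exact: lt0r_neq0.
have d10 : 0 < 1 + d by rewrite addr_gt0.
pose l := (1 + d)^-1.
have l01 : 0 <= l <= 1.
  by rewrite /l invr_ge0 ltW//= invf_le1// lerDl ltW.
have := concave_combination ch l01 Kx Ky.
have -> : (1 - l) *: x + l *: y = c.
  apply/rowP => i; rewrite !mxE /l; field; exact: lt0r_neq0.
have := h0 _ Ky => hy0 H.
have {}H : (1 - l) * h x <= h c.
  apply: le_trans H; rewrite lerDl mulr_ge0//; by case/andP: l01.
rewrite (_ : 1 - l = d / (1 + d)) in H; last by rewrite /l; field; exact: lt0r_neq0.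
have := ler_wpM2l (ltW (divr_gt0 d10 d0)) H; apply: le_trans.
by rewrite mulrA mulf_div [d * _]mulrC divff ?mul1r// lt0r_neq0// mulr_gt0.
Qed.

(** No condition on [x] is imposed: where the supremum does not exist, [sup] takes the default value
    0. *)
Lemma star_cube_ge0 K h x : (forall y, K y -> 0 <= h y) ->
  0 <= star_cube K h x.
Proof.
move=> h0; rewrite /star_cube; set S := (X in sup X).
have [hS|/sup_out->//] := pselect (has_sup S).
have [[v Sv] _] := hS.
apply: (le_trans _ (ub_le_sup hS.2 Sv)).
by case: Sv => u [_ Ku] <-; exact: h0.
Qed.

Lemma star_cube_ge K h x w (M : R) : (forall y, K y -> h y <= M) ->
  K w -> open_cube R n (x - w) -> h w <= star_cube K h x.
Proof.
move=> hM Kw xw; apply: ub_le_sup.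
  by exists M => _ [u [_ Ku] <-]; exact: hM.
by exists (x - w); rewrite /= subKr.
Qed.

End Lattice.

(** * Superlevel sets *)

Section LevelSets.
Variables (R : realType) (n : nat) (K : set 'rV[R]_n) (h : 'rV[R]_n -> R).
Variables (s1 s2 : seq 'rV[R]_n).
Hypotheses (hK : convex_body K) (K0 : K 0).
Hypotheses (h_ge0 : forall x, K x -> 0 <= h x) (h_concave : concave_function K h).
Hypotheses (us1 : uniq s1)
  (s1P : forall x, (x \in s1) <-> (K x /\ forall i, x 0 i \is a Num.int))
  (s2P : forall x, (x \in s2) <->
     (minkowski_sum K (open_cube R n) x /\ forall i, x 0 i \is a Num.int)).

(* [h] may be negative outside [K] *)
Local Notation u := (fun x => `|h x|).
Local Notation g := (star_cube K h).

Let N := (size s1)%:R : R.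

(** The origin lies in the cube, so [K] is contained in the Minkowski sum and [g] dominates [h] on
    [K]. *)
Lemma count_ge_star_cube t : 0 < t -> count_ge u s1 t <= count_ge g s2 t.
Proof.
move=> t0; have [M hM] := concave_bounded hK h_ge0 h_concave.
rewrite /count_ge ler_nat -!size_filter; apply: uniq_leq_size.
  exact: filter_uniq.
move=> x; rewrite !mem_filter => /andP[tx /s1P[Kx Zx]].
have x0 : open_cube R n (x - x) by move=> i; rewrite subrr mxE ltrN10 ltr01.
apply/andP; split.
  apply: le_trans (star_cube_ge hM Kx x0).
  by rewrite -(ger0_norm (h_ge0 Kx)).
apply/s2P; split => //; exists x => //; exists 0; last by rewrite addr0.
by rewrite -(subrr x).
Qed.

(** Write t = l t'. A lattice point of [K], where h >= 0, combined with one where h >= t' gives by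
    concavity a point v with h v >= t, and g >= t at every lattice point z with z - v in the cube.
    The discrete Brunn-Minkowski inequality counts these points. *)
Lemma level_brunn_minkowski a t t' : 0 < a -> 0 < t < t' ->
  0 < count_ge u s1 t' ->
  N * cone_profile n a t' <= count_ge u s1 t' ->
  N * cone_profile n a t <= count_ge g s2 t.
Proof.
move=> a0 /andP[t0 tt'] F0 HF.
have [M hM] := concave_bounded hK h_ge0 h_concave.
have t'0 : 0 < t' := lt_trans t0 tt'.
rewrite /cone_profile; case: (leP t a) => ta; last by rewrite !mulr0 /count_ge.
rewrite mulr1.
pose l := t / t'.
have l01 : 0 < l < 1 by rewrite divr_gt0//= ltr_pdivrMr// mul1r.
have [l0 l1] := andP l01.
have ls0 : s1 != [::].
  apply/eqP => s10; have : 0 \in s1 by apply/s1P; split => // i; rewrite mxE.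
  by rewrite s10.
have [r r0 rE] := root_size_rV us1 ls0.
pose B := [seq x <- s1 | t' <= u x].
pose C := [seq x <- s2 | t <= g x].
have sB : count_ge u s1 t' = (size B)%:R by rewrite /count_ge -size_filter.
have sC : count_ge g s2 t = (size C)%:R by rewrite /count_ge -size_filter.
have B0 : B != [::] by move: F0; rewrite sB ltr0n lt0n size_eq0.
rewrite sC.
(* For t' <= a the choice r (1 - t'/a) gives equality in the last condition. For t' > a, s = 0
   suffices since t/t' <= t/a; when n = 0 the value 0^0 = 1 is covered by [B] being nonempty. *)
have [s [s0 sn sl]] : exists s, [/\ 0 <= s, s ^+ n <= (size B)%:R &
    r * (1 - t / a) <= (1 - l) * r + l * s].
  case: (leP t' a) => t'a.
    exists (r * (1 - t' / a)); split.
    - by rewrite mulr_ge0 ?subr_ge0 ?ler_pdivrMr ?mul1r// ltW.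
    - rewrite exprMn rE -sB; apply: le_trans HF.
      by rewrite /cone_profile t'a mulr1.
    - rewrite le_eqVlt; apply/orP; left; apply/eqP; rewrite /l; field.
      by rewrite !lt0r_neq0.
  exists 0; split => //.
    rewrite expr0n (@le_trans _ _ 1)// ?lern1 ?leq_b1// ler1n lt0n size_eq0//.
  rewrite mulr0 addr0 mulrC ler_pM2r// lerD2l lerN2 /l.
  by rewrite ler_pM2l// lef_pV2// ltW.
apply: le_trans (discrete_brunn_minkowski (A := s1) (B := B) (C := C)
  (r := r) (s := s) l01 us1 (filter_uniq _ us1) ls0 B0 _ _ _ (ltW r0) s0 _ sn).
- rewrite /N -rE -exprMn lerXn2r// nnegrE.
    by rewrite mulr_ge0 ?subr_ge0 ?ler_pdivrMr ?mul1r// ltW.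
  by rewrite addr_ge0// mulr_ge0// ?subr_ge0 ltW.
- by move=> x /s1P[].
- by move=> x; rewrite mem_filter => /andP[_ /s1P[]].
- move=> x y z /s1P[Kx _]; rewrite mem_filter => /andP[ty /s1P[Ky _]] Zz xyz.
  have l01' : 0 <= l <= 1 by rewrite !ltW.
  set v := (1 - l) *: x + l *: y.
  have Kv : K v by apply: convex_combination => //; case: hK.
  have zv : open_cube R n (z - v).
    by move=> i; rewrite -ltr_norml /v !mxE.
  rewrite mem_filter; apply/andP; split.
    apply: le_trans (star_cube_ge hM Kv zv).
    apply: le_trans (concave_combination h_concave l01' Kx Ky).
    rewrite -[leLHS]add0r lerD//.
      by rewrite mulr_ge0 ?h_ge0// subr_ge0 ltW.
    rewrite -(ger0_norm (h_ge0 Ky)); apply: le_trans (ler_wpM2l (ltW l0) ty).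
    by rewrite /l divfK// lt0r_neq0.
  by apply/s2P; split => //; exists v => //; exists (z - v) => //; rewrite addrC subrK.
- by rewrite rE.
Qed.

End LevelSets.

(** * From integrals over the lattice point enumerator to finite sums *)

Theorem theorem2p3 (R : realType) (n : nat) (K : set 'rV[R]_n)
    (h : 'rV[R]_n -> R)
    (hK : convex_body K) (hK0 : K 0)
    (h_ge0 : forall x, K x -> 0 <= h x)
    (h_concave : concave_function K h)
    (p q : R) (hp : 0 < p) (hpq : p <= q) :
  (((gbinom n q)%:E / lattice_enum R n K
      * \int[lattice_enum R n]_(x in K) ((h x `^ q)%R)%:E) `^ q^-1
   <=
   ((gbinom n p)%:E / lattice_enum R n K
      * \int[lattice_enum R n]_(x in minkowski_sum K (open_cube R n))
          ((star_cube K h x `^ p)%R)%:E) `^ p^-1)%E.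
Proof.
have hq : 0 < q := lt_le_trans hp hpq.
have [cK kK iK] := hK; have [B B0 HB] := compact_coord_bound kK.
have [s1 us1 s1P] := lattice_points HB.
have HB' x : minkowski_sum K (open_cube R n) x -> forall i, `|x 0 i| <= B + 1.
  move=> [y Ky [z Cz <-]] i; rewrite mxE; apply: le_trans (ler_normD _ _) _.
  by rewrite lerD ?HB// ler_norml; have /andP[zl zu] := Cz i; rewrite !ltW.
have [s2 us2 s2P] := lattice_points HB'.
(* The origin is a lattice point of [K], so the division by the number of lattice points is
   genuine. *)
have N0 : 0 < (size s1)%:R :> R.
  rewrite ltr0n; have : 0 \in s1 by apply/s1P; split => // i; rewrite mxE.
  by case: s1 {us1 s1P}.
rewrite (lattice_enumE us1 s1P) inver (gt_eqF N0) !gbinomE//.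
rewrite (integral_lattice_enum (f := fun x => h x `^ q) us1 s1P); last first.
  by move=> x; exact: powR_ge0.
rewrite (integral_lattice_enum (f := fun x => star_cube K h x `^ p) us2 s2P);
  last by move=> x; exact: powR_ge0.
rewrite -!EFinM !poweR_EFin lee_fin.
(* [discrete_berwald] asks for nonnegative values everywhere, so [h] is replaced by its absolute
   value, which agrees with it on [K]. *)
rewrite big_seq; under eq_bigr => x /s1P[Kx _] do rewrite -(ger0_norm (h_ge0 x Kx)).
rewrite -big_seq.
apply: (@discrete_berwald R _ _ (fun x => `|h x|) (star_cube K h) s1 s2) => //.
- by move=> x; exact: star_cube_ge0.
- by move=> t; exact: count_ge_star_cube.
- by move=> a t t'; exact: level_brunn_minkowski.
Qed.
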